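(* Let $n,d\ge 1$ be integers and let $X_1,\dots,X_n$ be i.i.d. $\mathsf N(0,I_d)$. Let $\theta^\star\in\mathbb R^d$ and suppose that, conditionally on $X_1,\dots,X_n$, the labels $Y_1,\dots,Y_n\in\{-1,1\}$ are independent with $\mathbf P(Y_i=1\mid X_{1:n})=\sigma(\langle X_i,\theta^\star\rangle)$. Then, for every $\delta\in(0,1)$, $$\mathbf P_{\theta^\star}\Big(\Lambda_n^{\log}(\theta^\star)\le 4\cdot 10^{13}\big(d+\log(5/\delta)\big)\Big)\ge 1-\delta,$$ where the probability is over the joint law of $(X_{1:n},Y_{1:n})$.
   Context: $\sigma(t)=1/(1+e^{-t})$, and $$\Lambda_n^{\log}(\theta^\star)=\log\frac{\sup_{\theta\in\mathbb R^d}\prod_{i=1}^n\sigma(Y_i\langle X_i,\theta\rangle)}{\prod_{i=1}^n\sigma(Y_i\langle X_i,\theta^\star\rangle)}$$ is the log-likelihood ratio statistic of the logistic model. The supremum need not be attained. *)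

(* Defs.v *)
From HB Require Import structures.
From mathcomp Require Import all_boot all_order all_algebra.
From mathcomp Require Import all_classical all_reals all_analysis.

Set Implicit Arguments.
Unset Strict Implicit.
Unset Printing Implicit Defensive.

Import Order.TTheory GRing.Theory Num.Theory.
Import numFieldNormedType.Exports.

Local Open Scope classical_set_scope.
Local Open Scope ring_scope.

(* R^d is represented by d.-tuple R, which carries in the library the
   sigma-algebra generated by the coordinate projections, i.e. the Borel
   sigma-algebra of R^d. *)

Section Logistic.
Context {R : realType}.

Definition sigmoid (t : R) : R := 1 / (1 + expR (- t)).

Definition inner {d : nat} (x theta : d.-tuple R) : R :=
  \sum_(j < d) tnth x j * tnth theta j.

Definition likelihood {n d : nat} (x : 'I_n -> d.-tuple R) (y : 'I_n -> R)
    (theta : d.-tuple R) : R :=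
  \prod_(i < n) sigmoid (y i * inner (x i) theta).

(* Each likelihood lies in ]0, 1[ (or is 1 when n = 0), so the real-valued
   [sup] is a genuine supremum and the argument of [ln] is positive. *)
Definition log_likelihood_ratio {n d : nat} (x : 'I_n -> d.-tuple R)
    (y : 'I_n -> R) (theta : d.-tuple R) : R :=
  ln (sup (range (likelihood x y)) / likelihood x y theta).

End Logistic.

Section Probability.
Context {disp : measure_display} {T : measurableType disp} {R : realType}.

(* N(0, I_d) is the d-fold product of N(0, 1), characterized by its values on
   measurable rectangles; [normal_prob] takes the standard deviation. *)
Definition std_gaussian {d : nat} (mu : set (d.-tuple R) -> \bar R) : Prop :=
  forall A : 'I_d -> set R, (forall j, measurable (A j)) ->
    mu [set x | forall j, A j (tnth x j)] =
    (\prod_(j < d) normal_prob 0 1 (A j))%E.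

(* Taking some of the B i equal to setT gives the product rule for
   subfamilies. *)
Definition independent_family (P : probability T R)
    {disp' : measure_display} {E : measurableType disp'} {n : nat}
    (X : 'I_n -> T -> E) : Prop :=
  forall B : 'I_n -> set E, (forall i, measurable (B i)) ->
    P [set w | forall i, B i (X i w)] = (\prod_(i < n) P (X i @^-1` B i))%E.

(* f is a version of the conditional probability P(A | G), for a
   sub-sigma-algebra G. *)
Definition is_cond_prob (P : probability T R) (G : set (set T)) (A : set T)
    (f : T -> R) : Prop :=
  [/\ forall B : set R, measurable B -> G (f @^-1` B),
      P.-integrable setT (EFin \o f)
    & forall C, G C -> (\int[P]_(w in C) (f w)%:E)%E = P (A `&` C)].

(* P(Y_1 in B_1, ..., Y_n in B_n | G) = \prod_i P(Y_i in B_i | G) a.s.;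
   versions exist by Radon-Nikodym and are a.s. unique, so quantifying over all
   of them is the same as fixing one of each. *)
Definition cond_independent_family (P : probability T R) (G : set (set T))
    {disp' : measure_display} {E : measurableType disp'} {n : nat}
    (Y : 'I_n -> T -> E) : Prop :=
  forall (B : 'I_n -> set E) (f : 'I_n -> T -> R),
    (forall i, measurable (B i)) ->
    (forall i, is_cond_prob P G (Y i @^-1` B i) (f i)) ->
    is_cond_prob P G [set w | forall i, B i (Y i w)]
      (fun w => \prod_(i < n) f i w).

End Probability.

(* Main.v *)
(** The negative log-likelihood [loss] is convex, so it suffices to control it at
finitely many points. Put [s = |theta_star|] and let [norm2 w] be the quadratic
form [|w_par|^2 / (1 + s)^3 + |w_perp|^2 / (1 + s)], where [w_par] and [w_perp]
are the components of [w] along and orthogonal to [theta_star]. As long as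
[norm2 w <= 1 / (4 (1 + s))], the chi-square and Hellinger affinities between one
observation under [theta_star] and under [theta_star + w] are [1 + O(norm2 w)]
and at most [1 - c norm2 w]; by rotation invariance these are integrals over two
independent standard normals. Markov's inequality then bounds
[loss (theta_star + w) - loss theta_star] from above by [U] at lattice points
where [n * norm2 w] is of order [d + log (1 / delta)], and from below by [L > 0]
at those away from the origin, where the scale [rho] of the lattice ball is so
large that [U <= rho * L]. Supporting hyperplanes propagate both bounds from the
lattice to the whole space: a convex function vanishing at 0, at most [U] on a
ball and nonnegative on a sphere inside it is at least [- U] everywhere. When [n]
is too small for such a lattice to exist, the trivial bound
[log_likelihood_ratio <= loss theta_star = O(n / (1 + s) + log (1 / delta))]
suffices. *)
Require Import Defs.
From HB Require Import structures.
From mathcomp Require Import all_boot all_order all_algebra.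
From mathcomp Require Import all_classical all_reals all_analysis.
From mathcomp Require Import measurable_realfun ring lra.

Set Implicit Arguments.
Unset Strict Implicit.
Unset Printing Implicit Defensive.

Import Order.TTheory GRing.Theory Num.Theory.
Import numFieldNormedType.Exports.

Local Open Scope classical_set_scope.
Local Open Scope ring_scope.

#[local] Opaque expR ln.

(** * Softplus and the conditional moments of one observation *)

Section Real.
Context {R : realType}.
Implicit Types t x y g v : R.

(** A label is informative only where [|<X, theta_star>|] is of order 1. This inner product is a
    centered normal of standard deviation [s], so that happens with probability of order
    [1 / (1 + s)], and there the component of [X] along [theta_star] is itself of order
    [1 / (1 + s)]: hence the powers 3 and 1 in [norm2]. The chi-square affinity is the exponential
    moment of a loss increment with exponent 1, the Hellinger affinity the one with exponent -1/2.
    An apparent circularity shapes the constants: the scale [rho] must exceed [U / L], while the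
    number of lattice points grows with [rho]. It is harmless because [U] and [L] are both multiples
    of the same [tau], so that [U / L] is an absolute constant; the logarithm of the number of
    lattice points is then at most [41 d], which [tau = 41 d + log (5 / delta)] absorbs. Convexity
    replaces the usual net with a Lipschitz estimate, so the tail bounds never involve the size of
    the gradient of the loss. *)

Definition softplus t : R := ln (1 + expR (- t)).

Lemma softplus_arg_gt0 t : 0 < 1 + expR (- t).
Proof. by rewrite addr_gt0 ?expR_gt0. Qed.

Lemma expR_softplus t : expR (softplus t) = 1 + expR (- t).
Proof. by rewrite lnK// posrE softplus_arg_gt0. Qed.

Lemma sigmoidE t : sigmoid t = expR (- softplus t).
Proof. by rewrite expRN expR_softplus /sigmoid div1r. Qed.

Lemma softplusN t : softplus (- t) = softplus t + t.
Proof.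
apply: expR_inj; rewrite expRD !expR_softplus opprK mulrDl mul1r -expRD addNr.
by rewrite expR0 addrC.
Qed.

Lemma softplus_ge0 t : 0 <= softplus t.
Proof. by rewrite ln_ge0// lerDl expR_ge0. Qed.

Lemma sigmoidDN t : sigmoid t + sigmoid (- t) = 1.
Proof.
rewrite !sigmoidE softplusN opprD expRD -[X in X + _]mulr1 -mulrDr.
by rewrite expRN expR_softplus mulVf// gt_eqF// softplus_arg_gt0.
Qed.

(** After exponentiation this is [exp (s y) <= 1 - s + s exp y] with [s = sigmoid (- m)] and
    [y = m - x], the convexity of the exponential. It follows from [1 + t <= exp t] at two points
    whose weighted mean is 0. *)
Lemma softplus_subgradient m x :
  softplus m - sigmoid (- m) * (x - m) <= softplus x.
Proof.
rewrite -ler_expR expR_softplus expRD expR_softplus.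
have e0 := expR_gt0 (- m).
have hs : sigmoid (- m) = expR (- m) / (1 + expR (- m)).
  rewrite sigmoidE softplusN opprD expRD mulrC expRN (expRN (softplus m)).
  by rewrite expR_softplus -expRN.
have h0 : 1 + expR (- m) != 0 by rewrite gt_eqF// softplus_arg_gt0.
set s := sigmoid (- m) in hs *.
have -> : 1 + expR (- x) = (1 + expR (- m)) * (1 - s + s * expR (- (x - m))).
  have -> : expR (- x) = expR (- m) * expR (- (x - m)).
    by rewrite -expRD; congr expR; ring.
  by rewrite hs; field.
rewrite ler_pM2l ?softplus_arg_gt0//.
set y := - (x - m).
have -> : - (s * (x - m)) = s * y by rewrite /y; ring.
have s0 : 0 <= s by rewrite hs divr_ge0// ?ltW// softplus_arg_gt0.
have s1 : 0 <= 1 - s.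
  have -> : 1 - s = (1 + expR (- m))^-1 by rewrite hs; field.
  by rewrite invr_ge0 ltW// softplus_arg_gt0.
have -> : expR (s * y) = expR (s * y) * 1 by rewrite mulr1.
have -> : 1 - s + s * expR y =
  expR (s * y) * ((1 - s) * expR (- (s * y)) + s * expR (y - s * y)).
  rewrite expRD (expRN (s * y)).
  have ? : expR (s * y) != 0 by rewrite gt_eqF// expR_gt0.
  by field.
rewrite ler_pM2l ?expR_gt0//.
have := expR_ge1Dx (- (s * y)); have := expR_ge1Dx (y - s * y).
move=> h1 h2; have := ler_wpM2l s0 h1; have := ler_wpM2l s1 h2; nra.
Qed.

Lemma softplus_lipschitz x y : softplus y <= softplus x + `|x - y|.
Proof.
have := softplus_subgradient y x.
have h : `|sigmoid (- y) * (x - y)| <= `|x - y|.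
  rewrite normrM ler_piMl// ger0_norm ?sigmoidE ?expR_ge0//.
  by rewrite -[leRHS]expR0 ler_expR oppr_le0 softplus_ge0.
have := ler_norm (sigmoid (- y) * (x - y)); lra.
Qed.

#[local] Opaque softplus.

(* Conditional moments, given [g = <X, theta*>] and [v = <X, w>]; the exponents
   are those of Markov's inequality for [log (L theta* / L (theta* + w))]. *)
Definition chi2_moment g v := expR (- softplus g) * expR (softplus (g + v) - softplus g) +
  expR (- softplus (- g)) * expR (softplus (- (g + v)) - softplus (- g)).

Definition hellinger_moment g v :=
  expR (- softplus g) * expR (- 2^-1 * (softplus (g + v) - softplus g)) +
  expR (- softplus (- g)) * expR (- 2^-1 * (softplus (- (g + v)) - softplus (- g))).

Definition half_moment g :=
  expR (- softplus g) * expR (2^-1 * softplus g) +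
  expR (- softplus (- g)) * expR (2^-1 * softplus (- g)).

Lemma expRB1_le x : 0 <= x -> expR x - expR (- x) <= 2 * x * expR x.
Proof.
move=> x0.
have -> : expR (- x) = expR x * expR (- (2 * x)) by rewrite -expRD; congr expR; ring.
have := expR_ge1Dx (- (2 * x)); have := expR_gt0 x; nra.
Qed.

Lemma expRV_mul x : expR (- x) * expR x = 1.
Proof. by rewrite mulrC expRxMexpNx_1. Qed.

(** The excess over 1 equals [sigmoid g * sigmoid (- g)] times [4 sinh (v / 2) ^ 2]. The first
    factor is at most [exp (- |g|)], the source of the decay in the norm of the parameter after
    averaging. *)
Lemma chi2_moment_le g v :
  chi2_moment g v <= 1 + expR (- `|g|) * (v ^+ 2 * expR `|v|).
Proof.
pose E := expR (- g); have E0 : 0 < E := expR_gt0 _.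
pose V := expR (- v); have V0 : 0 < V := expR_gt0 _.
have h1 : V + V^-1 - 2 <= v ^+ 2 * expR `|v|.
  pose u := expR (`|v| / 2); have u0 : 0 < u := expR_gt0 _.
  have uE : expR `|v| = u ^+ 2 by rewrite -expRM_natr; congr expR; field.
  have -> : V + V^-1 - 2 = (u - u^-1) ^+ 2.
    have -> : V + V^-1 = u ^+ 2 + (u ^+ 2)^-1.
      rewrite /V expRN invrK -uE; have [v0|v0] := ger0P v; first by rewrite addrC.
      by rewrite expRN invrK.
    by field; rewrite gt_eqF.
  have -> : v ^+ 2 * expR `|v| = (2 * (`|v| / 2) * u) ^+ 2.
    by rewrite !exprMn uE -[in LHS](real_normK (num_real v)); field.
  have up : u - u^-1 <= 2 * (`|v| / 2) * u.
    by rewrite -[u^-1]expRN; apply: expRB1_le; rewrite divr_ge0.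
  have un : 0 <= u - u^-1.
    by rewrite subr_ge0 -[u^-1]expRN ler_expR; have := normr_ge0 v; lra.
  rewrite lerXn2r ?nnegrE//; exact: le_trans up.
have h2 : E / (1 + E) ^+ 2 <= expR (- `|g|).
  have e0 : 0 < (1 + E) ^+ 2 by rewrite exprn_gt0// addr_gt0.
  rewrite ler_pdivrMr//; have [g0|g0] := ger0P g; first by rewrite -/E; nra.
  rewrite opprK; have -> : expR g = E^-1 by rewrite /E expRN invrK.
  have : E^-1 * E = 1 by rewrite mulVf// gt_eqF.
  have : 0 < E^-1 by rewrite invr_gt0.
  by move: (E^-1) => F; nra.
have -> : chi2_moment g v = 1 + E / (1 + E) ^+ 2 * (V + V^-1 - 2).
  pose p := expR (softplus g); pose q := expR (softplus (g + v)).
  have pE : p = 1 + E by exact: expR_softplus.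
  have qE : q = 1 + E * V by rewrite /q expR_softplus opprD expRD.
  have eg : expR g = E^-1 by rewrite /E (expRN g) invrK.
  have ev : expR v = V^-1 by rewrite /V (expRN v) invrK.
  have m t u : expR (- softplus t) * expR (softplus u - softplus t) =
      expR (softplus u) / expR (softplus t) ^+ 2.
    rewrite (expRB (softplus u)) (expRN (softplus t)).
    have : expR (softplus t) != 0 by rewrite gt_eqF// expR_gt0.
    by move: (expR (softplus t)) (expR (softplus u)) => z y h0; field.
  have n t : expR (softplus (- t)) = expR (softplus t) * expR t.
    by rewrite (softplusN t) (expRD (softplus t)).
  rewrite /chi2_moment (m g) (m (- g)) (n g) (n (g + v)) -/p -/q.
  rewrite (expRD g) eg ev pE qE.
  move: (E) (V) E0 V0 => {h1 h2 eg ev pE qE} E' V' E0 V0.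
  by field; rewrite (gt_eqF E0) (gt_eqF V0) gt_eqF// addr_gt0.
rewrite lerD2l ler_pM// ?divr_ge0 ?sqr_ge0 ?(ltW E0)//.
have -> : V + V^-1 - 2 = (V - 1) ^+ 2 / V by field; rewrite gt_eqF.
by rewrite divr_ge0 ?sqr_ge0// (ltW V0).
Qed.

(** With [p = sigmoid g] the moment is [sqrt p + sqrt (1 - p)]: one root is at most 1, the other at
    most [exp (- |g| / 2)]. *)
Lemma half_moment_le g : half_moment g <= 1 + expR (- (`|g| / 2)).
Proof.
have e t : expR (- softplus t) * expR (2^-1 * softplus t) = expR (- (softplus t / 2)).
  by rewrite -expRD; congr expR; field.
have -> : half_moment g =
    expR (- (softplus g / 2)) + expR (- (softplus (- g) / 2)).
  by congr (_ + _); exact: e.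
have aux u : 0 <= u ->
    expR (- (softplus u / 2)) + expR (- (softplus (- u) / 2)) <= 1 + expR (- (u / 2)).
  move=> u0; rewrite lerD//.
    by rewrite -[leRHS]expR0 ler_expR oppr_le0 divr_ge0// softplus_ge0.
  rewrite ler_expR lerN2 ler_pM2r ?invr_gt0// softplusN.
  by rewrite lerDr softplus_ge0.
have [g0|/ltW g0] := ger0P g; first exact: aux.
rewrite -oppr_ge0 in g0; have := aux _ g0; rewrite (opprK g) => h.
by rewrite addrC.
Qed.

Lemma expR1_le3 : expR 1 <= 3 :> R.
Proof.
have h := expR_ge1Dx (- (8^-1) : R).
have e : expR (8^-1 : R) * expR (- (8^-1)) = 1 := expRxMexpNx_1 _.
have h8 : expR (8^-1 : R) <= 8 / 7.
  have := expR_gt0 (8^-1 : R); nra.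
have -> : (1 : R) = 8^-1 * 8%:R by field.
rewrite expRM_natr; apply: (@le_trans _ _ ((8 / 7) ^+ 8)); last by lra.
by rewrite lerXn2r ?nnegrE ?expR_ge0//; lra.
Qed.

Lemma sigmoid_ge_inv10 x : -2 <= x -> 10^-1 <= sigmoid x.
Proof.
move=> x2; rewrite /sigmoid div1r lef_pV2 ?posrE ?softplus_arg_gt0//.
have : expR (- x) <= expR (1 * 2%:R) by rewrite ler_expR; lra.
rewrite expRM_natr; have := expR1_le3; have := expR_gt0 (1 : R); nra.
Qed.

Lemma sigmoid_ge_inv4 x : -1 <= x -> 4^-1 <= sigmoid x.
Proof.
move=> x2; rewrite /sigmoid div1r lef_pV2 ?posrE ?softplus_arg_gt0//.
have : expR (- x) <= expR 1 by rewrite ler_expR; lra.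
have := expR1_le3; lra.
Qed.

(** Lagrange's identity for the unit vector [(sqrt (sigmoid g), sqrt (sigmoid (- g)))] and its
    analogue at [g + v], whose inner product is the affinity. *)
Lemma hellinger_moment_sqr g v : 1 - hellinger_moment g v ^+ 2 =
  sigmoid g * sigmoid (g + v) * (expR (- (g / 2)) - expR (- ((g + v) / 2))) ^+ 2.
Proof.
pose a t := expR (- (softplus t / 2)); pose x t := expR (- (t / 2)).
have e t u : expR (- softplus t) * expR (- 2^-1 * (softplus u - softplus t)) =
    a t * a u.
  by rewrite /a -!expRD; congr expR; field.
have aN t : a (- t) = a t * x t.
  by rewrite /a /x softplusN -expRD; congr expR; field.
have a2 t : a t ^+ 2 = sigmoid t.
  by rewrite sigmoidE /a -expRM_natr; congr expR; field.
have ax t : sigmoid t * (1 + x t ^+ 2) = 1.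
  have -> : x t ^+ 2 = expR (- t) by rewrite /x -expRM_natr; congr expR; field.
  by rewrite -expR_softplus sigmoidE expRV_mul.
have e1 := e g (g + v).
have e2 := etrans (e (- g) (- (g + v))) (congr2 *%R (aN g) (aN (g + v))).
have -> : hellinger_moment g v =
    a g * a (g + v) + a g * x g * (a (g + v) * x (g + v)) := congr2 +%R e1 e2.
move: (ax g) (ax (g + v)); rewrite -!a2 -/(x g) -/(x (g + v)).
move: (a g) (a (g + v)) (x g) (x (g + v)) => p q r s h1 h2.
by transitivity (p ^+ 2 * (1 + r ^+ 2) * (q ^+ 2 * (1 + s ^+ 2)) -
  (p * q + p * r * (q * s)) ^+ 2); [rewrite h1 h2 mulr1|ring].
Qed.

Lemma hellinger_moment_le1 g v : hellinger_moment g v <= 1.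
Proof.
have : 0 <= 1 - hellinger_moment g v ^+ 2.
  by rewrite hellinger_moment_sqr mulr_ge0 ?sqr_ge0// mulr_ge0// sigmoidE expR_ge0.
nra.
Qed.

Lemma hellinger_moment_le g v : `|g| <= 1 -> `|v| <= 1 ->
  hellinger_moment g v <= 1 - v ^+ 2 / 320.
Proof.
rewrite !ler_norml => /andP[g1 g2] /andP[v1 v2].
(* For any [h], [1 - h >= (1 - h ^+ 2) / 2]; hence the factor 2 between 160 and 320. *)
suff : v ^+ 2 / 160 <= 1 - hellinger_moment g v ^+ 2 by nra.
rewrite hellinger_moment_sqr.
have sx t : sigmoid (- t) = sigmoid t * expR (- (t / 2)) ^+ 2.
  by rewrite !sigmoidE softplusN -expRM_natr -expRD; congr expR; field.
have sg0 t : 0 < sigmoid t by rewrite sigmoidE expR_gt0.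
(* To be used with the larger of [g] and [g + v] as [u], where the factor [exp (- u)] turns
   [sigmoid u] into [sigmoid (- u)]. The two sigmoids then have arguments at least -1 and -2, so
   that [160 = 4 * 10 * 4]. *)
have key t u : t <= u -> (u - t) ^+ 2 / 4 * expR (- (u / 2)) ^+ 2 <=
    (expR (- (t / 2)) - expR (- (u / 2))) ^+ 2.
  move=> tu; have -> : expR (- (t / 2)) = expR (- (u / 2)) * expR ((u - t) / 2).
    by rewrite -expRD; congr expR; field.
  have := expR_ge1Dx ((u - t) / 2); have := expR_gt0 (- (u / 2)).
  set p := expR _; set q := expR _ => p0 q1.
  have -> : (p * q - p) ^+ 2 = (q - 1) ^+ 2 * p ^+ 2 by ring.
  rewrite ler_wpM2r ?sqr_ge0//; nra.
have [v0|/ltW v0] := ger0P v.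
  have := key g (g + v); rewrite lerDl => /(_ v0) k.
  have a1 : 4^-1 <= sigmoid g by apply: sigmoid_ge_inv4.
  have a2 : 10^-1 <= sigmoid (- (g + v)) by apply: sigmoid_ge_inv10; lra.
  rewrite sx in a2.
  apply: (@le_trans _ _ (4^-1 * 10^-1 * (v ^+ 2 / 4))); first by lra.
  apply: (@le_trans _ _ (sigmoid g * (sigmoid (g + v) * expR (- ((g + v) / 2)) ^+ 2)
     * (v ^+ 2 / 4))).
    by rewrite ler_wpM2r ?divr_ge0 ?sqr_ge0// ler_pM.
  have -> : sigmoid g * (sigmoid (g + v) * expR (- ((g + v) / 2)) ^+ 2) *
      (v ^+ 2 / 4) = sigmoid g * sigmoid (g + v) *
      (expR (- ((g + v) / 2)) ^+ 2 * (v ^+ 2 / 4)).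
    by move: (sigmoid g) (sigmoid _) (expR _) => p q r; ring.
  rewrite ler_wpM2l ?mulr_ge0 ?(ltW (sg0 _))//.
  by rewrite mulrC; move: k; rewrite [g + v - g]addrC addKr.
have := key (g + v) g; rewrite gerDl => /(_ v0) k.
have a1 : 4^-1 <= sigmoid (- g) by apply: sigmoid_ge_inv4; lra.
have a2 : 10^-1 <= sigmoid (g + v) by apply: sigmoid_ge_inv10; lra.
rewrite sx in a1.
apply: (@le_trans _ _ (4^-1 * 10^-1 * (v ^+ 2 / 4))); first by lra.
apply: (@le_trans _ _ ((sigmoid g * expR (- (g / 2)) ^+ 2) * sigmoid (g + v)
   * (v ^+ 2 / 4))).
  by rewrite ler_wpM2r ?divr_ge0 ?sqr_ge0// ler_pM.
rewrite -[X in _ <= _ * X]sqrrN opprB.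
have -> : sigmoid g * expR (- (g / 2)) ^+ 2 * sigmoid (g + v) * (v ^+ 2 / 4) =
  sigmoid g * sigmoid (g + v) * ((g - (g + v)) ^+ 2 / 4 * expR (- (g / 2)) ^+ 2).
  by field.
by rewrite ler_wpM2l// mulr_ge0 ?ltW.
Qed.
End Real.

(** * Convex functions controlled on a lattice *)

Section Lattice.
Context {R : realType} {d : nat}.
Implicit Types x y z m : 'I_d -> R.

Definition sqnorm x : R := \sum_(j < d) x j ^+ 2.

Lemma sqnormD_le x y : sqnorm (fun j => x j + y j) <= 2 * sqnorm x + 2 * sqnorm y.
Proof.
rewrite /sqnorm !mulr_sumr -big_split/=; apply: ler_sum => j _.
by have := sqr_ge0 (x j - y j); move: (x j) (y j) => a b; nra.
Qed.

Lemma sqnormZ (c : R) x : sqnorm (fun j => c * x j) = c ^+ 2 * sqnorm x.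
Proof. by rewrite /sqnorm mulr_sumr; apply: eq_bigr => j _; rewrite exprMn. Qed.

Lemma sqnorm_le_dim x : (forall j, `|x j| <= 1) -> sqnorm x <= d%:R.
Proof.
move=> x1; rewrite -[d in leRHS]card_ord -sum1_card natr_sum /=.
by apply: ler_sum => j _; rewrite -real_normK ?num_real// expr_le1.
Qed.

Definition has_subgradients (f : ('I_d -> R) -> R) := forall m,
  exists G : 'I_d -> R, forall x, f m + \sum_(j < d) G j * (x j - m j) <= f x.

Variable f : ('I_d -> R) -> R.
Hypothesis fG : has_subgradients f.

(* Rounding [z] coordinatewise in the direction given by the sign of the
   subgradient at [z] yields a lattice point where [f] is not smaller. *)
Lemma lattice_rounding_ge z : exists k : 'I_d -> int,
  (forall j, `|(k j)%:~R - z j| <= 1) /\ f z <= f (fun j => (k j)%:~R).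
Proof.
have [G hG] := fG z.
pose k j : int := Num.floor (z j) + (0 <= G j)%R%:R.
exists k; split=> [j|]; last first.
  apply: le_trans (hG _); rewrite lerDl; apply: sumr_ge0 => j _.
  have := floor_le_tmp (z j); have := floorD1_gt (z j).
  rewrite /k; case: (leP 0 (G j)) => G0 h1 h2.
    by rewrite mulr_ge0// subr_ge0 ltW.
  by rewrite addr0 nmulr_rge0// subr_le0.
have := floor_le_tmp (z j); have := floorD1_gt (z j).
rewrite /k ler_norml rmorphD/=; case: (0 <= G j)%R; rewrite /= ?rmorph1 ?rmorph0; lra.
Qed.

(** Rounding moves a point by at most [sqrt d]. Hence lattice points up to radius [3 rho sqrt d]
    control [f] on the ball of radius [2 rho sqrt d], and those obtained from the sphere of radius
    [rho sqrt d] stay outside radius [rho sqrt (d / 3)]; [rho >= 3] leaves enough room for both. *)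
Lemma lattice_lower_bound (rho U L : R) :
  f (fun=> 0) = 0 -> 3 <= rho -> 0 <= U -> U <= rho * L ->
  (forall k : 'I_d -> int,
    sqnorm (fun j => (k j)%:~R) <= 9 * rho ^+ 2 * d%:R -> f (fun j => (k j)%:~R) <= U) ->
  (forall k : 'I_d -> int, rho ^+ 2 / 3 * d%:R <= sqnorm (fun j => (k j)%:~R) ->
    sqnorm (fun j => (k j)%:~R) <= 9 * rho ^+ 2 * d%:R -> L <= f (fun j => (k j)%:~R)) ->
  forall x, - U <= f x.
Proof.
move=> f0 rho3 U0 UL hU hL.
have d0 : 0 <= d%:R :> R by [].
have r2 : 9 <= rho ^+ 2 by rewrite (_ : 9 = 3 ^+ 2); [rewrite lerXn2r ?nnegrE//; lra|ring].
have ball z : sqnorm z <= 4 * rho ^+ 2 * d%:R -> f z <= U.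
  move=> hz; have [k [k1 fzk]] := lattice_rounding_ge z.
  apply: le_trans fzk _; apply: hU.
  have := sqnormD_le z (fun j => (k j)%:~R - z j).
  have := sqnorm_le_dim k1.
  have -> : sqnorm (fun j => z j + ((k j)%:~R - z j)) = sqnorm (fun j => (k j)%:~R).
    by congr sqnorm; apply/funext => j; rewrite addrC subrK.
  nra.
(* The lattice point [k = v + e] lies between [v] and [z = v + rho * e], with weight [1 / rho] on
   [z]. Since [L <= f k] and [f z <= U <= rho * L], convexity forces [f v >= 0]. The ball has radius
   [2 rho sqrt d] in order to contain [z]. *)
have sphere v : sqnorm v = rho ^+ 2 * d%:R -> 0 <= f v.
  move=> hv; pose k j : int := Num.floor (v j).
  pose e j : R := (k j)%:~R - v j.
  have e1 : sqnorm e <= d%:R.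
    apply: sqnorm_le_dim => j; rewrite /e /k.
    have := floor_le_tmp (v j); have := floorD1_gt (v j).
    rewrite ler_norml rmorphD/= ?rmorph1; lra.
  have kE : sqnorm (fun j => v j + e j) = sqnorm (fun j => (k j)%:~R).
    by congr sqnorm; apply/funext => j; rewrite /e addrC subrK.
  have vE : sqnorm (fun j => (k j)%:~R + - 1 * e j) = sqnorm v.
    by congr sqnorm; apply/funext => j; rewrite /e; ring.
  have k2 := sqnormD_le v e.
  have v2 := sqnormD_le (fun j => (k j)%:~R) (fun j => - 1 * e j).
  rewrite vE sqnormZ in v2; rewrite kE in k2.
  have Lk : L <= f (fun j => (k j)%:~R) by apply: hL; nra.
  have [G hG] := fG (fun j => (k j)%:~R).
  have z2 := sqnormD_le v (fun j => rho * e j); rewrite sqnormZ in z2.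
  have Uz : f (fun j => v j + rho * e j) <= U by apply: ball; nra.
  have Gz := hG (fun j => v j + rho * e j).
  have Gv := hG v.
  have zE : \sum_(j < d) G j * (v j + rho * e j - (k j)%:~R) =
            (rho - 1) * \sum_(j < d) G j * e j.
    by rewrite mulr_sumr; apply: eq_bigr => j _; rewrite /e; ring.
  have wE : \sum_(j < d) G j * (v j - (k j)%:~R) = - \sum_(j < d) G j * e j.
    by rewrite -sumrN; apply: eq_bigr => j _; rewrite /e; ring.
  rewrite zE in Gz; rewrite wE in Gv.
  move: (\sum_(j < d) _) (f _) (f v) (f _) Lk Uz Gz Gv => S fk fv fz Lk Uz Gz Gv.
  nra.
(* Inside the sphere, the supporting hyperplane at 0 gives [f x + f (- x) >= 0], and [- x] lies in
   the ball too. *)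
move=> x; have [xs|xs] := leP (sqnorm x) (rho ^+ 2 * d%:R).
  have Ux : f (fun j => - 1 * x j) <= U.
    by apply: ball; rewrite sqnormZ; nra.
  have [G hG] := fG (fun=> 0).
  have := hG x; have := hG (fun j => - 1 * x j); rewrite f0 !add0r.
  have -> : \sum_(j < d) G j * (- 1 * x j - 0) = - \sum_(j < d) G j * (x j - 0).
    by rewrite -sumrN; apply: eq_bigr => j _; ring.
  lra.
have x0 : 0 < sqnorm x by apply: le_lt_trans xs; nra.
pose t := Num.sqrt (rho ^+ 2 * d%:R / sqnorm x).
have t2 : t ^+ 2 * sqnorm x = rho ^+ 2 * d%:R.
  rewrite sqr_sqrtr ?divfK ?gt_eqF// divr_ge0 ?(ltW x0)//; nra.
have t1 : t < 1.
  rewrite -[1]sqrtr1 ltr_sqrt// ltr_pdivrMr// mul1r//.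
have d1 : 0 < d%:R :> R.
  rewrite ltr0n lt0n; apply: contraTneq x0 => d0'.
  by rewrite /sqnorm big1 ?ltxx// => j; move: (ltn_ord j); rewrite [in X in (_ < X)%N]d0'.
have t0 : 0 < t by rewrite sqrtr_gt0 divr_gt0// mulr_gt0// exprn_gt0//; lra.
have fv := sphere (fun j => t * x j); rewrite sqnormZ in fv; have {}fv := fv t2.
have [G hG] := fG (fun j => t * x j).
have G0 := hG (fun=> 0); rewrite f0 in G0; have Gx := hG x.
have e0 : \sum_(j < d) G j * (0 - t * x j) = - t * \sum_(j < d) G j * x j.
  by rewrite mulr_sumr; apply: eq_bigr => j _; ring.
have ex : \sum_(j < d) G j * (x j - t * x j) = (1 - t) * \sum_(j < d) G j * x j.
  by rewrite mulr_sumr; apply: eq_bigr => j _; ring.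
rewrite e0 in G0; rewrite ex in Gx.
move: (\sum_(j < d) _) (f _) fv (f x) G0 Gx => S fv fv0 fx G0 Gx.
(* The value 0 at the origin and the nonnegative value on the sphere make the slope along the ray
   nonnegative, so [f] stays nonnegative beyond the sphere. *)
have S0 : 0 <= S by rewrite -(pmulr_rge0 _ t0); lra.
nra.
Qed.

End Lattice.

(* [int]s of absolute value less than [m] are coded by a sign and an ['I_m];
   0 is counted twice. *)
Lemma sum_expR_sqr_le {R : realType} (r : R) (m : nat) : 1 <= r ->
  \sum_(p : bool * 'I_m) expR (- (p.2%:R ^+ 2 / r ^+ 2)) <= 12 * (r + 1).
Proof.
move=> r1.
rewrite (eq_bigr (fun p : bool * 'I_m => (fun=> fun i : 'I_m => expR (- (i%:R ^+ 2 / r ^+ 2))) p.1 p.2))//.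
rewrite -(pair_bigA _ (fun (b : bool) (i : 'I_m) => expR (- (i%:R ^+ 2 / r ^+ 2))))/=.
rewrite big_bool/=.
pose q : R := expR (- r^-1).
have r0 : 0 < r by lra.
have q1 : q < 1 by rewrite expR_lt1 oppr_lt0 invr_gt0.
have q0 : 0 < q := expR_gt0 _.
(* The inequality [u ^+ 2 >= u - 1] replaces the Gaussian sum by a geometric series. *)
have le1 (i : 'I_m) : expR (- (i%:R ^+ 2 / r ^+ 2)) <= 3 * q ^+ i.
  rewrite /q -expRM_natr (_ : - r^-1 * i%:R = - (i%:R / r)); last by ring.
  apply: (@le_trans _ _ (expR 1 * expR (- (i%:R / r)))).
    rewrite -expRD ler_expR -expr_div_n; set u := i%:R / r.
    have := sqr_ge0 (u - 2^-1); lra.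
  by rewrite ler_wpM2r ?expR_ge0 ?expR1_le3.
have S : \sum_(i < m) q ^+ i <= r + 1.
  have h : (1 - q) * \sum_(i < m) q ^+ i = 1 - q ^+ m.
    by rewrite -[1 - q]opprB mulNr -subrX1 opprB.
  have h1 : (1 - q) * (r + 1) >= 1.
    have qr : q * expR r^-1 = 1 by rewrite mulrC expRxMexpNx_1.
    have := expR_ge1Dx r^-1.
    have : r^-1 * r = 1 by rewrite mulVf// gt_eqF.
    have : 0 < r^-1 by rewrite invr_gt0.
    move: (r^-1) (expR _) qr => ri E qr ri0 rir Eg.
    have : q * (1 + ri) <= 1 by nra.
    nra.
  have qm : 0 <= q ^+ m by rewrite exprn_ge0// ltW.
  by rewrite -(@ler_pM2l _ (1 - q)) ?subr_gt0// h; lra.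
have : \sum_(i < m) expR (- (i%:R ^+ 2 / r ^+ 2)) <= 3 * (r + 1).
  by apply: le_trans (ler_sum _ (fun i _ => le1 i)) _; rewrite -mulr_sumr; lra.
lra.
Qed.

(** * Densities and product laws *)

Section Density.
Context d (T : measurableType d) (R : realType).
Variables m mu : {measure set T -> \bar R}.
Variable f : T -> R.
Hypothesis mf : measurable_fun setT f.
Hypothesis f0 : forall x, 0 <= f x.
Hypothesis mE : forall A, measurable A -> m A = (\int[mu]_(x in A) (f x)%:E)%E.
Local Open Scope ereal_scope.
Import HBNNSimple.

(** Serves three times: for the normal density, for the restriction of [P] to an event, whose
    density is an indicator, and for a conditional probability read as a density with respect to the
    law of the design. *)
Lemma ge0_integral_density (h : T -> \bar R) :
  measurable_fun setT h -> (forall x, 0 <= h x) ->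
  \int[m]_x h x = \int[mu]_x (h x * (f x)%:E).
Proof.
move=> mh h0; pose g := nnsfun_approx measurableT mh.
have mfE : measurable_fun setT (EFin \o f) by exact/measurable_EFinP.
have nd x : {homo (fun n => g n x) : a b / (a <= b)%N >-> (a <= b)%R}.
  by move=> a b ab; exact/lefP/nd_nnsfun_approx.
have gh x : (EFin \o g ^~ x) @ \oo --> h x by exact: cvg_nnsfun_approx.
transitivity (limn (fun n => \int[m]_x (g n x)%:E)).
  rewrite -monotone_convergence//.
  - by apply: eq_integral => x _; apply/esym/cvg_lim => //; exact: gh.
  - by move=> n; exact/measurable_EFinP.
  - by move=> n x _; rewrite lee_fin.
  - by move=> x _ a b ab; rewrite lee_fin nd.
transitivity (limn (fun n => \int[mu]_x ((g n x)%:E * (f x)%:E))); last first.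
  rewrite -monotone_convergence//.
  - apply: eq_integral => x _; apply/cvg_lim => //.
    by apply: cvgeZr => //; exact: gh.
  - by move=> n; apply: emeasurable_funM => //; exact/measurable_EFinP.
  - by move=> n x _; rewrite mule_ge0 ?lee_fin.
  - by move=> x _ a b ab; rewrite lee_wpmul2r ?lee_fin ?nd.
congr (limn _); apply/funext => n.
rewrite integralT_nnsfun sintegralE.
transitivity (\int[mu]_x \sum_(y \in range (g n)) (y%:E * (\1_(g n @^-1` [set y]) x * f x)%:E)).
  rewrite ge0_integral_fsum//; last 2 first.
  - move=> y; apply: emeasurable_funM => //; apply/measurable_EFinP.
    exact: measurable_funM.
  - move=> y x _; have [->|/set0P[t /= ty]] := eqVneq (g n @^-1` [set y]) set0.
      by rewrite indic0 mul0r mule0.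
    by rewrite -ty mule_ge0// lee_fin// mulr_ge0.
  apply: eq_fsbigr => y /[!inE] -[t _ <-].
  rewrite ge0_integralZl//; last 3 first.
  - by apply/measurable_EFinP; exact: measurable_funM.
  - by move=> x _; rewrite lee_fin mulr_ge0.
  - by rewrite lee_fin.
  rewrite mE//; congr (_ * _); rewrite integral_mkcond; apply: eq_integral => x _.
  by rewrite patchE indicE; case: ifPn => _; rewrite ?mul1r ?mul0r.
apply: eq_integral => x _.
rewrite [in RHS]fimfunE -fsumEFin// ge0_mule_fsuml//.
  by apply: eq_fsbigr => y _; rewrite -!EFinM mulrA.
by move=> y; exact: nnfun_muleindic_ge0.
Qed.
End Density.

Section Tuples.
Context {d} {E : measurableType d} {R : realType}.

Definition mfun_pack {d1 d2} {T1 : measurableType d1} {T2 : measurableType d2}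
    (f : T1 -> T2) (mf : measurable_fun setT f) : {mfun T1 >-> T2} :=
  HB.pack f (isMeasurableFun.Build _ _ _ _ f mf).

Definition box n (A : 'I_n -> set E) : set (n.-tuple E) :=
  [set x | forall i, A i (tnth x i)].

Lemma measurable_box n (A : 'I_n -> set E) :
  (forall i, measurable (A i)) -> measurable (box A).
Proof.
move=> mA.
have -> : box A = \big[setI/setT]_(i < n) ((fun x => tnth x i) @^-1` A i).
  rewrite -bigcap_seq; apply/seteqP; split=> [x h i _|x h i]; first exact: h.
  by apply: h; rewrite /= mem_index_enum.
apply: bigsetI_measurable => i _; rewrite -[X in measurable X]setTI.
exact: measurable_tnth.
Qed.

Lemma tuple_measure_unique n (m1 m2 : {measure set (n.-tuple E) -> \bar R}) :
  (forall A, (forall i, measurable (A i)) -> m1 (box A) = m2 (box A)) ->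
  (m1 setT < +oo)%E -> forall D, measurable D -> m1 D = m2 D.
Proof.
move=> m12 m1T.
pose G : set (set (n.-tuple E)) :=
  [set B | exists2 A, (forall i, measurable (A i)) & B = box A].
have boxT : box (fun=> setT) = [set: n.-tuple E] by apply/seteqP; split.
have GT : G setT by exists (fun=> setT) => //.
apply: (measure_unique G (fun=> setT)) => //.
- apply/seteqP; split.
    apply: smallest_sub; first exact: smallest_sigma_algebra.
    rewrite -bigcup_seq => B [i _ [A mA <-]]; apply: sub_sigma_algebra.
    exists (fun j => if j == i then A else setT).
      by move=> j; case: ifP.
    apply/seteqP; split=> [x [_ Ax] j|x /(_ i)]; rewrite ?eqxx//.
    by case: eqP => [->|].
  apply: smallest_sub; first exact: sigma_algebra_measurable.
  by move=> B [A mA ->]; exact: measurable_box.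
- move=> B C [A mA ->] [A' mA' ->]; exists (fun i => A i `&` A' i).
    by move=> i; exact: measurableI.
  apply/seteqP; split=> [x [h1 h2] i|x h]; first by split; [exact: h1|exact: h2].
  by split=> i; have [] := h i.
- by rewrite bigcup_const.
- by move=> B [A mA ->]; exact: m12.
Qed.

(** Values on boxes determine the measure, and this form agrees with [std_gaussian] and with
    [independent_family] as they stand. *)
Definition product_law n (nu : 'I_n -> probability E R)
    (mu : {measure set (n.-tuple E) -> \bar R}) :=
  forall A, (forall i, measurable (A i)) ->
    mu (box A) = (\prod_(i < n) nu i (A i))%E.

Lemma tuple_consE n (x : n.+1.-tuple E) :
  [tuple of thead x :: [tuple of behead x]] = x.
Proof. by rewrite [RHS]tuple_eta; apply: val_inj. Qed.

(** Here [mu'] is the law of the tail, and uniqueness is used twice: with the event on the head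
    fixed, two finite measures of the tail agree on boxes; then agreement on rectangles identifies
    the law of (head, tail) with a product measure, to which Tonelli's theorem applies. *)
Lemma product_law_cons n (nu : 'I_n.+1 -> probability E R)
    (mu : probability (n.+1.-tuple E) R) : product_law nu mu ->
  exists2 mu' : probability (n.-tuple E) R,
    product_law (fun i => nu (lift ord0 i)) mu' &
    forall f : n.+1.-tuple E -> \bar R,
      measurable_fun setT f -> (forall x, (0 <= f x)%E) ->
      (\int[mu]_x f x = \int[nu ord0]_z \int[mu']_x f [tuple of z :: x])%E.
Proof.
move=> hmu.
have mb := @measurable_behead _ E n.
pose bh := mfun_pack mb.
pose mu' : probability (n.-tuple E) R := distribution mu bh.
have mt : measurable_fun setT (fun x : n.+1.-tuple E => thead x).
  exact: measurable_tnth.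
have boxE (A0 : set E) (A : 'I_n -> set E) :
    (@thead n E) @^-1` A0 `&` bh @^-1` (box A) =
    box (fun i => oapp A A0 (unlift ord0 i)).
  apply/seteqP; split=> [x [h0 h] i|x h].
    case: unliftP => [j ->|->]//=.
    by have := h j; rewrite /= tnth_behead; congr (A j (tnth x _)); apply: val_inj; rewrite /= inordK// ltnS.
  split=> [|i]; first by have := h ord0; rewrite unlift_none.
  have := h (lift ord0 i); rewrite liftK /= tnth_behead.
  by congr (A i (tnth x _)); apply: val_inj; rewrite /= inordK// ltnS.
have hbox (A0 : set E) (A : 'I_n -> set E) : measurable A0 ->
    (forall i, measurable (A i)) ->
    mu ((@thead n E) @^-1` A0 `&` bh @^-1` (box A)) =
    (nu ord0 A0 * \prod_(i < n) nu (lift ord0 i) (A i))%E.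
  move=> mA0 mA; rewrite boxE hmu; last by move=> i; case: unliftP => [j _|_] /=; [exact: mA|].
  rewrite big_ord_recl unlift_none; congr (_ * _)%E.
  by apply: eq_bigr => i _; rewrite liftK.
have hmu' : product_law (fun i => nu (lift ord0 i)) mu'.
  move=> A mA; have := hbox setT A measurableT mA.
  by rewrite preimage_setT setTI probability_setT mul1e.
exists mu' => // f mf f0.
pose sp (x : n.+1.-tuple E) := (thead x, bh x).
have msp : measurable_fun setT sp by exact: measurable_fun_pair.
pose m' := distribution mu (mfun_pack msp).
have prodE : forall X, measurable X -> (nu ord0 \x mu')%E X = m' X.
  apply: product_measure_unique => A B mA mB.
  have mA' : measurable ((@thead n E) @^-1` A).
    by rewrite -[X in measurable X]setTI; exact: mt.
  have r0 : 0 <= fine (nu ord0 A) by exact: fine_ge0.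
  have r0E : (fine (nu ord0 A))%:E = nu ord0 A by rewrite fineK// fin_num_measure.
  have h : mu (bh @^-1` B `&` (@thead n E) @^-1` A) =
      ((fine (nu ord0 A))%:E * mu' B)%E.
    apply: (tuple_measure_unique
      (m1 := pushforward (mrestr mu mA') bh) (m2 := mscale (NngNum r0) mu')) => //.
    - move=> A1 mA1; have := hbox A A1 mA mA1.
      rewrite setIC -(hmu' A1 mA1) => e; apply: (etrans e).
      by rewrite -[in LHS]r0E.
    - have hT : (mu (bh @^-1` setT `&` (@thead n E) @^-1` A) <= 1)%E.
        by rewrite preimage_setT setTI; exact: probability_le1.
      exact: le_lt_trans hT (ltry 1).
  rewrite r0E in h; apply: (etrans _ h).
  by congr (mu _); apply/seteqP; split=> x [].
pose cons (p : E * n.-tuple E) : n.+1.-tuple E := [tuple of p.1 :: p.2].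
have mcons : measurable_fun setT cons by exact: measurable_cons.
transitivity (\int[mu]_x ((f \o cons) \o sp) x)%E.
  by apply: eq_integral => x _ /=; rewrite /cons /sp/= tuple_consE.
rewrite -[LHS](@ge0_integral_distribution _ _ _ _ _ mu (mfun_pack msp) (f \o cons)); last 2 first.
- exact: measurableT_comp.
- by move=> y; exact: f0.
rewrite (eq_measure_integral (nu ord0 \x mu')%E); last first.
  by move=> A mA _; exact: (esym (prodE A mA)).
by rewrite fubini_tonelli1//; [exact: measurableT_comp|move=> p; exact: f0].
Qed.
End Tuples.

Section ProductIntegral.
Context {d} {E : measurableType d} {R : realType}.

Lemma product_law_integral_prod n (nu : 'I_n -> probability E R)
    (mu : probability (n.-tuple E) R) (F : 'I_n -> E -> R) :
  product_law nu mu -> (forall i, measurable_fun setT (F i)) ->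
  (forall i x, 0 <= F i x) ->
  (\int[mu]_x (\prod_(i < n) F i (tnth x i))%:E =
   \prod_(i < n) \int[nu i]_x (F i x)%:E)%E.
Proof.
elim: n nu mu F => [|n IH] nu mu F hmu mF F0.
  rewrite big_ord0; under eq_integral do rewrite big_ord0.
  by rewrite integral_cst// mul1e; exact: probability_setT.
have [mu' hmu' ->] := product_law_cons hmu; last 2 first.
- apply/measurable_EFinP; apply: measurable_prod => i _.
  by apply: measurableT_comp => //; exact: measurable_tnth.
- by move=> x; rewrite lee_fin prodr_ge0.
rewrite big_ord_recl -(IH _ mu' (fun i => F (lift ord0 i)))//.
rewrite -ge0_integralZr//; last 3 first.
- exact/measurable_EFinP.
- by move=> x _; rewrite lee_fin.
- by apply: integral_ge0 => x _; rewrite lee_fin prodr_ge0.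
apply: eq_integral => z _.
rewrite -ge0_integralZl//; last 3 first.
- apply/measurable_EFinP; apply: measurable_prod => i _.
  by apply: measurableT_comp => //; exact: measurable_tnth.
- by move=> x _; rewrite lee_fin prodr_ge0.
- by rewrite lee_fin.
apply: eq_integral => x _.
rewrite -EFinM big_ord_recl; congr (_ * _)%:E.
by apply: eq_bigr => i _; rewrite tnthS.
Qed.
End ProductIntegral.

(** * Linear images of Gaussian vectors *)

Section Affine.
Context {R : realType}.
Local Notation mu := (@lebesgue_measure R).
Local Open Scope ereal_scope.

Lemma lebesgue_measure_affine (a b : R) (A : set R) : a != 0%R -> measurable A ->
  mu ((fun x => a * x + b)%R @^-1` A) = (`|a|^-1)%:E * mu A.
Proof.
move=> a0 mA.
have maff : measurable_fun setT (fun x : measurableTypeR R => a * x + b : measurableTypeR R)%R.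
  by apply: measurable_funD => //; exact: measurable_funM.
have h X : ocitv X ->
    mu X = mscale (NngNum (normr_ge0 a)) (pushforward mu (mfun_pack maff)) X.
  move=> [[x y]] _ <-; rewrite /mscale/= /pushforward/=.
  have [an|ap|] := ltgtP a 0%R; last by move/eqP; rewrite (negbTE a0).
    (* A negative slope exchanges the open and the closed end of the interval. *)
    rewrite (_ : _ @^-1` _ = `[(y - b) / a, (x - b) / a[%classic)%R; last first.
      apply/seteqP; split=> z /=; rewrite !in_itv/= ler_ndivrMr// ltr_ndivlMr//;
      by rewrite lerBrDr ltrBlDr (mulrC z) andbC.
    rewrite !lebesgue_measure_itv/= !lte_fin ltr_nM2r ?invr_lt0// ltrD2r.
    case: ifP => _; last by rewrite mule0.
    by rewrite -!EFinD -EFinM ltr0_norm//; congr EFin; field.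
  rewrite (_ : _ @^-1` _ = `](x - b) / a, (y - b) / a]%classic)%R; last first.
    apply/seteqP; split=> z /=; rewrite !in_itv/= ler_pdivlMr// ltr_pdivrMr//;
    by rewrite lerBrDr ltrBlDr (mulrC z).
  rewrite !lebesgue_measure_itv/= !lte_fin ltr_pM2r ?invr_gt0// ltrD2r.
  case: ifP => _; last by rewrite mule0.
  by rewrite -!EFinD -EFinM gtr0_norm//; congr EFin; field.
have -> : mu A = `|a|%:E * mu ((fun x => a * x + b)%R @^-1` A).
  exact: lebesgue_measure_unique (h maff) _ mA.
rewrite muleA -EFinM mulVf ?normr_eq0//.
by rewrite mul1e.
Qed.

Lemma ge0_integral_affine (a b : R) (g : R -> \bar R) : a != 0%R ->
  measurable_fun setT g -> (forall x, 0 <= g x) ->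
  \int[mu]_x g (a * x + b)%R = (`|a|^-1)%:E * \int[mu]_x g x.
Proof.
move=> a0 mg g0.
have maff : measurable_fun setT (fun x : measurableTypeR R => a * x + b : measurableTypeR R)%R.
  by apply: measurable_funD => //; exact: measurable_funM.
have ai0 : (0 <= `|a|^-1)%R by rewrite invr_ge0.
rewrite -[LHS](@ge0_integral_pushforward _ _ _ _ _ (mfun_pack maff) (measurable_funP _) mu setT g)//.
rewrite (eq_measure_integral (mscale (NngNum ai0) mu)); last first.
  by move=> A mA _; exact: lebesgue_measure_affine.
by rewrite ge0_integral_mscale.
Qed.
End Affine.

Lemma measurable_idR {R : realType} :
  measurable_fun setT (id : measurableTypeR R -> R).
Proof. by move=> _ B mB; rewrite setTI; exact: mB. Qed.

(* [normal_prob] lives on [measurableTypeR R], whose display differs from that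
   of [R]; this is the same probability on [R]. *)
Definition std_normal {R : realType} : probability R R :=
  distribution (normal_prob 0 1 : probability (measurableTypeR R) R)
    (mfun_pack measurable_idR).

Lemma integral_probability_cst d (T : measurableType d) (R : realType)
  (P : probability T R) (y : \bar R) : (\int[P]__ y = y)%E.
Proof. by rewrite integral_cst// [X in (_ * X)%E]probability_setT mule1. Qed.

Section Gauss2.
Context {R : realType}.
Local Notation mu := (@lebesgue_measure R).
Local Notation nu := (@std_normal R).
Local Notation phi := (@normal_pdf R 0 1).
Local Open Scope ereal_scope.

Lemma normal_pdf01E (x : R) : phi x = (normal_peak 1 * expR (- (x ^+ 2 / 2)))%R.
Proof. by rewrite normal_pdfE// /normal_fun subr0 expr1n mulNr. Qed.

Lemma ge0_integral_normal (h : R -> \bar R) :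
  measurable_fun setT h -> (forall x, 0 <= h x) ->
  \int[nu]_x h x = \int[mu]_x (h x * (phi x)%:E).
Proof.
move=> mh h0; rewrite ge0_integral_distribution//; apply: ge0_integral_density => //.
- exact: measurable_normal_pdf.
- by move=> x; exact: normal_pdf_ge0.
Qed.

Lemma measurable_lin2 (a b c e : R) :
  measurable_fun setT (fun p : R * R => (a * p.1 + b * p.2, c * p.1 + e * p.2)%R).
Proof.
by apply: measurable_fun_pair; apply: measurable_funD => //; exact: measurable_funM.
Qed.

Lemma ge0_integral_normal2 (h : R * R -> \bar R) :
  measurable_fun setT h -> (forall p, 0 <= h p) ->
  \int[nu]_z \int[nu]_w h (z, w) =
  \int[mu]_z \int[mu]_w (h (z, w) * (phi z * phi w)%:E).
Proof.
move=> mh h0.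
have mh1 z : measurable_fun setT (fun w => h (z, w)).
  by apply: measurableT_comp => //; exact: measurable_pair1.
rewrite ge0_integral_normal; last 2 first.
- exact: (measurable_fun_fubini_tonelli_F (m2 := nu) h mh).
- by move=> z; exact: integral_ge0.
apply: eq_integral => z _; rewrite ge0_integral_normal//.
rewrite -ge0_integralZr//; last 3 first.
- apply: emeasurable_funM; first exact: mh1.
  by apply/measurable_EFinP; exact: measurable_normal_pdf.
- by move=> w _; rewrite mule_ge0// lee_fin normal_pdf_ge0.
- by rewrite lee_fin normal_pdf_ge0.
by apply: eq_integral => w _; rewrite -muleA -EFinM [in RHS]mulrC.
Qed.

(** Two affine substitutions in one variable: [p = c z - s w] at fixed [z], then, after Tonelli, the
    second output at fixed [p]. The Jacobians [1 / |s|] and [|s|] cancel. When [s = 0] only sign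
    changes remain. *)
Lemma lebesgue2_rotation (c s : R) (H : R * R -> \bar R) :
  (c ^+ 2 + s ^+ 2 = 1)%R -> measurable_fun setT H -> (forall p, 0 <= H p) ->
  \int[mu]_z \int[mu]_w H (c * z + - s * w, s * z + c * w)%R =
  \int[mu]_z \int[mu]_w H (z, w).
Proof.
move=> cs1 mH H0.
have mH1 z : measurable_fun setT (fun w => H (z, w)).
  by apply: measurableT_comp => //; exact: measurable_pair1.
have mF := measurable_fun_fubini_tonelli_F (m2 := mu) H mH.
have F0 z : 0 <= \int[mu]_w H (z, w) by exact: integral_ge0.
have [s0|s0] := eqVneq s 0%R.
  have c0 : c != 0%R.
    by apply: contra_eq_neq cs1 => ->; rewrite s0 expr0n addr0 eq_sym oner_eq0.
  have c1 : (`|c|^-1 = 1)%R.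
    have /eqP := cs1; rewrite s0 expr0n addr0 sqrf_eq1 => /orP[]/eqP ->;
    by rewrite ?normrN normr1 invr1.
  transitivity (\int[mu]_z \int[mu]_w H (c * z + 0, w)%R).
    apply: eq_integral => z _.
    have := @ge0_integral_affine _ c 0%R (fun w => H (c * z, w)%R) c0 (mH1 _) (fun=> H0 _).
    rewrite c1 mul1e addr0 => <-; apply: eq_integral => w _.
    by congr (H (_, _)); rewrite s0; ring.
  by rewrite (@ge0_integral_affine _ c 0%R _ c0 (mF H0) F0) c1 mul1e.
have sn0 : (- s != 0)%R by rewrite oppr_eq0.
(* [K (z, p)] is [H] at the rotated point, with [w] eliminated through [p = c z - s w]. *)
pose K (p : R * R) := H (p.2, (s^-1 * p.1 + - (c / s) * p.2))%R.
have mK : measurable_fun setT K.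
  apply: measurableT_comp => //.
  apply: measurable_fun_pair; first exact: measurable_snd.
  by apply: measurable_funD; exact: measurable_funM.
have K0 p : 0 <= K p by exact: H0.
have mK1 z : measurable_fun setT (fun w => K (z, w)).
  by apply: measurableT_comp => //; exact: measurable_pair1.
transitivity (\int[mu]_z ((`|s|^-1)%:E * \int[mu]_p K (z, p))).
  apply: eq_integral => z _.
  have := @ge0_integral_affine _ (- s)%R (c * z)%R (fun p => K (z, p)) sn0 (mK1 _) (fun=> K0 _).
  rewrite normrN => <-; apply: eq_integral => w _.
  have cs2 : (c ^+ 2 = 1 - s ^+ 2)%R by rewrite -cs1 addrK.
  rewrite /K/=; congr (H (_, _)); first by ring.
  transitivity (s^-1 * ((1 - c ^+ 2) * z + c * s * w))%R; last by field.
  by rewrite cs2; field.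
have mFK := measurable_fun_fubini_tonelli_F (m2 := mu) K mK.
rewrite ge0_integralZl//; last 2 first.
- exact: (mFK K0).
- by move=> z _; exact: integral_ge0.
transitivity ((`|s|^-1)%:E * \int[mu]_p \int[mu]_z K (z, p)).
  by congr (_ * _); exact: fubini_tonelli.
transitivity ((`|s|^-1)%:E * \int[mu]_p (`|s|%:E * \int[mu]_q H (p, q))).
  congr (_ * _); apply: eq_integral => p _; rewrite /K/=.
  have si0 : (s^-1 != 0)%R by rewrite invr_eq0.
  have := @ge0_integral_affine _ (s^-1)%R (- (c / s) * p)%R (fun q => H (p, q)) si0 (mH1 _) (fun=> H0 _).
  by rewrite normfV invrK => <-.
rewrite ge0_integralZl//; last exact: (mF H0).
by rewrite muleA -EFinM mulVf ?normr_eq0// mul1e.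
Qed.

Lemma normal2_rotation (c s : R) (h : R * R -> \bar R) :
  (c ^+ 2 + s ^+ 2 = 1)%R -> measurable_fun setT h -> (forall p, 0 <= h p) ->
  \int[nu]_z \int[nu]_w h (c * z + - s * w, s * z + c * w)%R =
  \int[nu]_z \int[nu]_w h (z, w).
Proof.
move=> cs1 mh h0.
pose rot (p : R * R) := (c * p.1 + - s * p.2, s * p.1 + c * p.2)%R.
have mrot : measurable_fun setT rot by exact: measurable_lin2.
rewrite (ge0_integral_normal2 (h := h \o rot) (measurableT_comp mh mrot) (fun=> h0 _)).
rewrite (ge0_integral_normal2 mh h0).
pose H (p : R * R) := h p * (phi p.1 * phi p.2)%:E.
rewrite -(lebesgue2_rotation (H := H) cs1); last 2 first.
- apply: emeasurable_funM => //; apply/measurable_EFinP.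
  by apply: measurable_funM; apply: measurableT_comp;
    rewrite ?measurable_fst ?measurable_snd//; exact: measurable_normal_pdf.
- by move=> p; rewrite mule_ge0// lee_fin mulr_ge0 ?normal_pdf_ge0.
apply: eq_integral => z _; apply: eq_integral => w _; rewrite /H/=.
congr (_ * _%:E); rewrite !normal_pdf01E.
transitivity (normal_peak 1 * normal_peak 1 * expR (- ((z ^+ 2 + w ^+ 2) / 2)))%R.
  by rewrite mulrACA -expRD; congr (_ * expR _)%R; field.
rewrite mulrACA -expRD; congr (_ * expR _)%R.
transitivity (- ((c ^+ 2 + s ^+ 2) * (z ^+ 2 + w ^+ 2) / 2))%R.
  by rewrite cs1 mul1r.
by field.
Qed.

(* A linear change of the two inputs: rotating so that the first output depends
   on the first input only (one step of a QR factorization). *)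
Lemma normal2_triangular (p q p' q' : R) : exists a b c : R,
  [/\ (0 <= a)%R, (a ^+ 2 = p ^+ 2 + q ^+ 2)%R, (a * b = p * p' + q * q')%R,
      (b ^+ 2 + c ^+ 2 = p' ^+ 2 + q' ^+ 2)%R &
    forall F : R * R -> \bar R, measurable_fun setT F -> (forall x, 0 <= F x) ->
      \int[nu]_z \int[nu]_w F (p * z + q * w, p' * z + q' * w)%R =
      \int[nu]_z \int[nu]_w F (a * z, b * z + c * w)%R].
Proof.
pose a := Num.sqrt (p ^+ 2 + q ^+ 2).
have a2 : (a ^+ 2 = p ^+ 2 + q ^+ 2)%R by rewrite sqr_sqrtr// addr_ge0// sqr_ge0.
have [a0|a0] := eqVneq a 0%R.
  move/eqP: a2; rewrite a0 expr0n/= eq_sym paddr_eq0 ?sqr_ge0// !sqrf_eq0.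
  move=> /andP[/eqP -> /eqP ->].
  exists 0%R, p', q'; split.
  - by [].
  - by rewrite expr0n addr0.
  - by rewrite !mul0r addr0.
  - by [].
  - move=> F mF F0; apply: eq_integral => z _; apply: eq_integral => w _.
    by rewrite !mul0r addr0.
pose c := (p / a)%R; pose s := (- (q / a))%R.
have cs1 : (c ^+ 2 + s ^+ 2 = 1)%R.
  rewrite /c /s sqrrN !expr_div_n -mulrDl -a2 divff// sqrf_eq0//.
exists a, (c * p' - s * q')%R, (s * p' + c * q')%R; split.
- exact: sqrtr_ge0.
- exact: a2.
- by rewrite /c /s; field.
- transitivity ((c ^+ 2 + s ^+ 2) * (p' ^+ 2 + q' ^+ 2))%R; first by ring.
  by rewrite cs1 mul1r.
move=> F mF F0.
pose G (x : R * R) := F (a * x.1 + 0 * x.2, (c * p' - s * q') * x.1 + (s * p' + c * q') * x.2)%R.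
have mG : measurable_fun setT G by apply: measurableT_comp => //; exact: measurable_lin2.
transitivity (\int[nu]_z \int[nu]_w G (z, w)); last first.
  by apply: eq_integral => z _; apply: eq_integral => w _; rewrite /G/= mul0r addr0.
rewrite -(normal2_rotation cs1 mG (fun=> F0 _)).
apply: eq_integral => z _; apply: eq_integral => w _; rewrite /G/=.
congr (F (_, _)); first by rewrite /c /s; field.
transitivity ((c ^+ 2 + s ^+ 2) * (p' * z + q' * w))%R; last by ring.
by rewrite cs1 mul1r.
Qed.
End Gauss2.

Section GaussianLaw.
Context {R : realType}.
Local Notation nu := (@std_normal R).
Local Open Scope ereal_scope.

Lemma measurable_inner d (u : d.-tuple R) :
  measurable_fun setT (fun x : d.-tuple R => inner x u).
Proof.
rewrite /inner; apply: measurable_sum => j.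
by apply: measurable_funM => //; exact: measurable_tnth.
Qed.

Lemma inner_cons d (z : R) (x : d.-tuple R) (u : d.+1.-tuple R) :
  inner [tuple of z :: x] u = (z * thead u + inner x [tuple of behead u])%R.
Proof.
rewrite /inner big_ord_recl; congr (_ + _)%R.
apply: eq_bigr => j _; rewrite tnthS; congr (_ * _)%R.
by rewrite tnth_behead; congr (tnth u _); apply: val_inj; rewrite /= inordK// ltnS.
Qed.

Lemma measurable_lin3 (a b c : R) :
  measurable_fun setT (fun q : (R * R) * R => a * q.1.1 + b * q.2 + c * q.1.2)%R.
Proof.
have m1 : measurable_fun setT (fun q : (R * R) * R => q.1.1).
  exact: (measurableT_comp measurable_fst measurable_fst).
have m2 : measurable_fun setT (fun q : (R * R) * R => q.1.2).
  exact: (measurableT_comp measurable_snd measurable_fst).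
by apply: measurable_funD; [apply: measurable_funD|]; exact: measurable_funM.
Qed.

Lemma tonelli3 (H : (R * R) * R -> \bar R) :
  measurable_fun setT H -> (forall q, 0 <= H q) ->
  \int[nu]_z \int[nu]_t \int[nu]_w H ((z, t), w) =
  \int[nu]_t \int[nu]_z \int[nu]_w H ((z, t), w).
Proof.
move=> mH H0.
apply: (fubini_tonelli (fun p : R * R => \int[nu]_w H (p, w))).
  exact: (measurable_fun_fubini_tonelli_F (m2 := nu) H mH H0).
by move=> p; exact: integral_ge0.
Qed.

Lemma tonelli2 (h : R * R -> \bar R) : measurable_fun setT h -> (forall q, 0 <= h q) ->
  \int[nu]_z \int[nu]_w h (z, w) = \int[nu]_w \int[nu]_z h (z, w).
Proof. by move=> mh h0; exact: (fubini_tonelli h). Qed.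

(** The numbers [a], [b], [c] are a Cholesky factor of the Gram matrix of [u] and [v]. A new
    coordinate brings in a third normal variable, and two plane rotations remove it: one makes the
    first output depend on a single variable, the other merges the two remaining noises of the
    second output. *)
Lemma gaussian_pair_law d (mu : probability (d.-tuple R) R) (u v : d.-tuple R) :
  product_law (fun=> nu) mu -> exists a b c : R,
  [/\ (0 <= a)%R, (a ^+ 2 = inner u u)%R, (a * b = inner u v)%R,
      (b ^+ 2 + c ^+ 2 = inner v v)%R &
    forall F : R * R -> \bar R, measurable_fun setT F -> (forall x, 0 <= F x) ->
      \int[mu]_x F (inner x u, inner x v) =
      \int[nu]_z \int[nu]_w F (a * z, b * z + c * w)%R].
Proof.
elim: d mu u v => [|d IH] mu u v hmu.
  exists 0%R, 0%R, 0%R; rewrite /inner !big_ord0; split.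
  - by [].
  - by rewrite expr0n.
  - by rewrite mul0r.
  - by rewrite expr0n addr0.
  move=> F mF F0; under eq_integral do rewrite !big_ord0.
  under [RHS]eq_integral do under eq_integral do rewrite !mul0r addr0.
  by rewrite !integral_probability_cst.
have [mu' hmu' muE] := product_law_cons hmu.
have [a [b [c [a0 a2 ab bc IHF]]]] := IH mu' [tuple of behead u] [tuple of behead v] hmu'.
pose p := thead u; pose p' := thead v.
have [a1 [b1 [c1 [a10 a12 ab1 bc1 E1]]]] := normal2_triangular p a p' b.
have [c2 [e2 [f2 [c20 c22 _ _ E2]]]] := normal2_triangular c c1 0 0.
have innerE (x y : d.+1.-tuple R) : inner x y =
    (thead x * thead y + inner [tuple of behead x] [tuple of behead y])%R.
  by rewrite -{1}(tuple_consE x) inner_cons.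
exists a1, b1, c2; split.
- by [].
- by rewrite a12 a2 innerE expr2.
- by rewrite ab1 ab innerE.
- rewrite c22 innerE -bc -/p' -expr2.
  by transitivity (b1 ^+ 2 + c1 ^+ 2 + c ^+ 2)%R; [ring|rewrite bc1; ring].
move=> F mF F0.
rewrite muE; last 2 first.
- apply: measurableT_comp => //.
  by apply: measurable_fun_pair; exact: measurable_inner.
- by move=> x; exact: F0.
(* The last variable is the one shared by both outputs in the induction hypothesis, and the middle
   one is the noise of the second output. Once the latter is integrated outermost, the first
   rotation acts on the other two. *)
pose G (q : (R * R) * R) : \bar R :=
  F (p * q.1.1 + a * q.2 + 0 * q.1.2, p' * q.1.1 + b * q.2 + c * q.1.2)%R.
have mG : measurable_fun setT G.
  by apply: measurableT_comp => //; apply: measurable_fun_pair; exact: measurable_lin3.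
pose G2 (q : (R * R) * R) : \bar R :=
  F (a1 * q.1.1 + 0 * q.2 + 0 * q.1.2, b1 * q.1.1 + c1 * q.2 + c * q.1.2)%R.
have mG2 : measurable_fun setT G2.
  by apply: measurableT_comp => //; apply: measurable_fun_pair; exact: measurable_lin3.
transitivity (\int[nu]_z \int[nu]_t \int[nu]_w G ((z, t), w)).
  apply: eq_integral => z _.
  pose Fz (y : R * R) := F (p * z + y.1, p' * z + y.2)%R.
  have mFz : measurable_fun setT Fz.
    apply: measurableT_comp => //; apply: measurable_fun_pair;
    by apply: measurable_funD.
  transitivity (\int[mu']_x Fz (inner x [tuple of behead u], inner x [tuple of behead v])).
    by apply: eq_integral => x _; rewrite !inner_cons /Fz (mulrC z) (mulrC z).
  rewrite (IHF Fz mFz (fun=> F0 _)).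
  rewrite (tonelli2 (h := fun y => Fz (a * y.1, b * y.1 + c * y.2)%R)).
  - apply: eq_integral => t _; apply: eq_integral => w _.
    by rewrite /G /Fz/= mul0r addr0 addrA.
  - apply: measurableT_comp => //; apply: measurable_fun_pair; first exact: measurable_funM.
    by apply: measurable_funD; exact: measurable_funM.
  - by move=> y; exact: F0.
rewrite (tonelli3 mG (fun=> F0 _)).
transitivity (\int[nu]_t \int[nu]_z \int[nu]_w G2 ((z, t), w)).
  apply: eq_integral => t _.
  pose Ft (y : R * R) := F (y.1, y.2 + c * t)%R.
  have mFt : measurable_fun setT Ft.
    by apply: measurableT_comp => //; apply: measurable_fun_pair => //; exact: measurable_funD.
  have := E1 Ft mFt (fun=> F0 _).
  under eq_integral do under eq_integral do rewrite /Ft/=.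
  under [X in _ = X -> _]eq_integral do under eq_integral do rewrite /Ft/=.
  move=> e; rewrite /G /G2/=.
  under eq_integral do under eq_integral do rewrite mul0r addr0.
  under [RHS]eq_integral do under eq_integral do rewrite !mul0r !addr0.
  exact: e.
rewrite -(tonelli3 mG2 (fun=> F0 _)).
apply: eq_integral => z _.
pose Fz (y : R * R) := F (a1 * z, b1 * z + y.1)%R.
have mFz : measurable_fun setT Fz.
  apply: measurableT_comp => //; apply: measurable_fun_pair => //.
  exact: measurable_funD.
transitivity (\int[nu]_t \int[nu]_w Fz (c * t + c1 * w, 0 * t + 0 * w)%R).
  apply: eq_integral => t _; apply: eq_integral => w _.
  by rewrite /G2 /Fz/= !mul0r !addr0 -addrA (addrC (c1 * w)%R).
rewrite (E2 Fz mFz (fun=> F0 _)).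
by apply: eq_integral => t _; rewrite /Fz/= integral_probability_cst.
Qed.
End GaussianLaw.

(** * Gaussian averages of the conditional moments *)

Section Moments.
Context {R : realType}.
Local Notation nu := (@std_normal R).
Local Notation mu := (@lebesgue_measure R).
Local Notation phi := (@normal_pdf R 0 1).

Lemma normal_peak_bounds : 3^-1 <= normal_peak (1 : R) /\ normal_peak (1 : R) * expR (2^-1) <= 1.
Proof.
have pi2 := @pi_ge2 R; have pi4 := @pihalf_lt2 R.
rewrite /normal_peak expr1n mul1r.
set q := Num.sqrt _.
have q2 : q ^+ 2 = pi *+ 2 by rewrite sqr_sqrtr// mulrn_wge0//; lra.
have q0 : 0 < q by rewrite sqrtr_gt0 mulrn_wgt0//; lra.
have e2 : expR (2^-1) ^+ 2 <= 3 :> R.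
  by rewrite -expRM_natr mulVf//; exact: expR1_le3.
split; first by rewrite lef_pV2 ?posrE//; nra.
rewrite mulrC ler_pdivrMr// mul1r.
have := expR_gt0 (2^-1 : R); nra.
Qed.

Lemma normal_pdf_le_exp (z : R) : phi z <= expR (- `|z|).
Proof.
have [_ h] := normal_peak_bounds.
rewrite normal_pdf01E.
have le : expR (- (z ^+ 2 / 2)) <= expR (2^-1) * expR (- `|z|).
  rewrite -expRD ler_expR -(real_normK (num_real z)).
  have := sqr_ge0 (`|z| - 1); lra.
apply: (le_trans (ler_wpM2l (normal_peak_ge0 1) le)).
by rewrite mulrA ler_piMl ?expR_ge0.
Qed.

(** Since the normal density is at most [exp (- |z|)], the integrand is dominated by
    [k exp (- r |z|)], of integral [2 k / r]. Rates [r] of order [1 + a] then produce the negative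
    powers of [1 + a]. *)
Lemma integral_normal_le_exp (h : R -> R) (k r : R) :
  measurable_fun setT h -> 0 <= k -> 0 < r ->
  (forall z, 0 <= h z <= k * expR ((1 - r) * `|z|)) ->
  (\int[nu]_z (h z)%:E <= (2 * k / r)%:E)%E.
Proof.
move=> mh k0 r0 hk.
have h0 z : 0 <= h z by case/andP: (hk z).
have r0' := ltW r0.
rewrite ge0_integral_normal; last 2 first.
- exact/measurable_EFinP.
- by move=> z; rewrite lee_fin.
pose p (z : R) := exponential_pdf r z.
have p0 z : 0 <= p z by exact: exponential_pdf_ge0.
have mp : measurable_fun setT p by exact: measurable_exponential_pdf.
have mpE : measurable_fun setT (fun z => (p z)%:E) by exact/measurable_EFinP.
have mpN : measurable_fun setT (fun z : R => (p (- 1 * z + 0))%:E).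
  by apply: (measurableT_comp mpE); apply: measurable_funD.
have ip : (\int[mu]_z (p (- 1 * z + 0)%R)%:E = 1)%E.
  rewrite (@ge0_integral_affine _ (-1) 0 (fun z => (p z)%:E))//.
    by rewrite normrN normr1 invr1 mul1e; exact: integral_exponential_pdf.
have -> : ((2 * k / r)%:E = \int[mu]_z ((k / r)%:E * ((p z)%:E + (p (- 1 * z + 0)%R)%:E)))%E.
  rewrite ge0_integralZl//; last 3 first.
  - exact: emeasurable_funD.
  - by move=> z _; rewrite adde_ge0 ?lee_fin.
  - by rewrite lee_fin divr_ge0.
  rewrite ge0_integralD//; last 2 first.
  - by move=> z _; rewrite lee_fin.
  - by move=> z _; rewrite lee_fin.
  rewrite ip integral_exponential_pdf// -EFinD -EFinM; congr EFin.
  by field; rewrite gt_eqF.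
apply: ge0_le_integral => //.
- by move=> z _; rewrite -EFinM lee_fin mulr_ge0 ?normal_pdf_ge0.
- apply/measurable_EFinP; apply: measurable_funM => //.
  exact: measurable_normal_pdf.
- apply: emeasurable_funM => //; exact: emeasurable_funD.
move=> z _; rewrite -EFinM -EFinD -EFinM lee_fin.
have key : k * expR (- r * `|z|) <= k / r * (p z + p (- 1 * z + 0)).
  have -> : k / r * (p z + p (- 1 * z + 0)) = k * ((p z + p (- 1 * z + 0)) / r).
    by field; rewrite gt_eqF.
  rewrite ler_wpM2l// ler_pdivlMr// mulrC.
  have [z0|z0] := ger0P z.
    by rewrite /p (exponential_pdfE _ z0) lerDl; exact: p0.
  have z0' : 0 <= - 1 * z + 0 by lra.
  by rewrite [p (- 1 * z + 0)]exponential_pdfE// addr0 mulN1r lerDr.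
apply: le_trans key.
have /andP[_ hz] := hk z.
apply: le_trans (ler_pM (h0 z) (normal_pdf_ge0 _ _ _) hz (normal_pdf_le_exp z)) _.
rewrite -mulrA -expRD ler_wpM2l// ler_expR; lra.
Qed.

(** On [[-1, 1]] the density is at least [1/3 * 1/2]. *)
Lemma std_normal_itv_ge (x y : R) : -1 <= x -> x <= y -> y <= 1 ->
  (((y - x) / 6)%:E <= nu `[x, y]%classic)%E.
Proof.
move=> x1 xy y1.
rewrite [leRHS](_ : _ = (\int[mu]_(z in `[x, y]) (phi z)%:E)%E)//.
have -> : (((y - x) / 6)%:E = \int[mu]_(z in `[x, y]) (6^-1)%:E)%E.
  rewrite integral_cst//= lebesgue_measure_itv/= lte_fin.
  have [_|yx] := ltP x y; first by rewrite -EFinD -EFinM mulrC.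
  have -> : y = x by apply/le_anti; rewrite yx.
  by rewrite subrr mul0r mule0.
apply: ge0_le_integral => //=.
- apply/measurable_EFinP; apply: measurable_funTS.
  exact: measurable_normal_pdf.
move=> z; rewrite in_itv/= => /andP[xz zy]; rewrite lee_fin normal_pdf01E.
have [h _] := normal_peak_bounds.
have e : 2^-1 <= expR (- (z ^+ 2 / 2)) by have := expR_ge1Dx (- (z ^+ 2 / 2)); nra.
apply: le_trans (ler_pM _ _ h e); rewrite ?invr_ge0//; lra.
Qed.

Lemma measurable_softplus : measurable_fun setT (@softplus R).
Proof.
have -> : @softplus R = @ln R \o (fun t => 1 + expR (- t)) by [].
apply: measurableT_comp; first exact: measurable_ln.
apply: measurable_funD => //; apply: measurableT_comp => //.
Qed.

Lemma measurable_expR_comp d (T : measurableType d) (f : T -> R) :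
  measurable_fun setT f -> measurable_fun setT (fun x => expR (f x)).
Proof. by move=> mf; apply: measurableT_comp. Qed.

Lemma measurable_oppr_comp d (T : measurableType d) (f : T -> R) :
  measurable_fun setT f -> measurable_fun setT (fun x => - f x).
Proof. by move=> mf; apply: measurableT_comp. Qed.

Lemma measurable_mulr_comp d (T : measurableType d) (c : R) (f : T -> R) :
  measurable_fun setT f -> measurable_fun setT (fun x => c * f x).
Proof. by move=> mf; apply: measurable_funM. Qed.

Lemma measurable_half_moment : measurable_fun setT (@half_moment R).
Proof.
have m := measurable_softplus.
have mN : measurable_fun setT (fun t : R => softplus (- t)) by exact: measurableT_comp.
by apply: measurable_funD; apply: measurable_funM; apply: measurable_expR_comp;
  (apply: measurable_oppr_comp || apply: measurable_mulr_comp).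
Qed.

Lemma measurable_pair_moment (c : R) (f : R * R -> R) :
  f = (fun p => expR (- softplus p.1) * expR (c * (softplus (p.1 + p.2) - softplus p.1)) +
  expR (- softplus (- p.1)) * expR (c * (softplus (- (p.1 + p.2)) - softplus (- p.1)))) ->
  measurable_fun setT f.
Proof.
move=> ->; have m := measurable_softplus.
have mN : measurable_fun setT (fun t : R => softplus (- t)) by exact: measurableT_comp.
have m1 : measurable_fun setT (fun p : R * R => softplus p.1) by exact: measurableT_comp.
have mD : measurable_fun setT (fun p : R * R => p.1 + p.2) by exact: measurable_funD.
have m2 : measurable_fun setT (fun p : R * R => softplus (p.1 + p.2)) by exact: (measurableT_comp m).
have m3 : measurable_fun setT (fun p : R * R => softplus (- p.1)) by exact: (measurableT_comp mN).
have m4 : measurable_fun setT (fun p : R * R => softplus (- (p.1 + p.2))) by exact: (measurableT_comp mN).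
by apply: measurable_funD; apply: measurable_funM; apply: measurable_expR_comp;
  (apply: measurable_oppr_comp || (apply: measurable_mulr_comp; apply: measurable_funB)).
Qed.

Lemma measurable_chi2_moment : measurable_fun setT (fun p : R * R => chi2_moment p.1 p.2).
Proof.
by apply: (measurable_pair_moment (c := 1)); apply/funext => p; rewrite !mul1r.
Qed.

Lemma measurable_hellinger_moment :
  measurable_fun setT (fun p : R * R => hellinger_moment p.1 p.2).
Proof. exact: (measurable_pair_moment (c := - 2^-1)). Qed.

Lemma chi2_moment_ge0 (g v : R) : 0 <= chi2_moment g v.
Proof. by rewrite addr_ge0// mulr_ge0// expR_ge0. Qed.

Lemma hellinger_moment_ge0 (g v : R) : 0 <= hellinger_moment g v.
Proof. by rewrite addr_ge0// mulr_ge0// expR_ge0. Qed.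

Lemma half_moment_ge0 (g : R) : 0 <= half_moment g.
Proof. by rewrite addr_ge0// mulr_ge0// expR_ge0. Qed.

Lemma half_moment_integral_le (a : R) : 0 <= a ->
  (\int[nu]_z (half_moment (a * z))%:E <= (1 + 4 / (1 + a))%:E)%E.
Proof.
move=> a0.
have mh : measurable_fun setT (fun z => expR (- (`|a * z| / 2))).
  apply: measurable_expR_comp; apply: measurable_oppr_comp.
  by apply: measurable_funM => //; apply: measurableT_comp.
apply: (@le_trans _ _ (\int[nu]_z (1%:E + (expR (- (`|a * z| / 2)))%:E)))%E.
  apply: ge0_le_integral => //.
  - by move=> z _; rewrite lee_fin half_moment_ge0.
  - apply/measurable_EFinP; apply: measurableT_comp; first exact: measurable_half_moment.
    exact: measurable_mulr_comp.
  - by apply: emeasurable_funD => //; exact/measurable_EFinP.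
  - by move=> z _; rewrite -EFinD lee_fin half_moment_le.
rewrite ge0_integralD//; last exact/measurable_EFinP.
rewrite integral_probability_cst EFinD leeD2l//.
have ra : 0 < 1 + a / 2 by lra.
apply: (@le_trans _ _ (2 * 1 / (1 + a / 2))%:E).
  apply: integral_normal_le_exp => // z; rewrite expR_ge0/= mul1r ler_expR.
  rewrite normrM (ger0_norm a0); lra.
rewrite lee_fin ler_pdivrMr// mulrAC ler_pdivlMr; lra.
Qed.

(* [norm2] below, in the coordinates where [<X, theta>] is [a z] and [<X, w>] is
   [b z + c w] for independent standard normal inputs. *)
Definition local_norm2 (a b c : R) := b ^+ 2 / (1 + a) ^+ 3 + c ^+ 2 / (1 + a).

(** Trades a quadratic factor for [32 / B ^+ 2] and a quarter of [B] in the decay rate; integration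
    then contributes the third power of [1 / B]. *)
Lemma sqr_mul_exp_le (x B : R) : 0 < B ->
  x ^+ 2 <= 32 / B ^+ 2 * expR (B / 4 * `|x|).
Proof.
move=> B0; have e := @expR_ge1Dxn R (B / 4 * `|x|) 1 _.
have {e} : 1 + (B / 4 * `|x|) ^+ 2 / 2 <= expR (B / 4 * `|x|).
  by apply: e; rewrite mulr_ge0// divr_ge0// ltW.
set E := expR _; rewrite exprMn real_normK ?num_real// => e.
rewrite mulrAC ler_pdivlMr ?exprn_gt0//.
have : (B / 4) ^+ 2 * x ^+ 2 / 2 <= E by lra.
have -> : (B / 4) ^+ 2 * x ^+ 2 / 2 = x ^+ 2 * B ^+ 2 / 32 by field.
lra.
Qed.

(** The pointwise bound is a sum of products of a function of [z] and one of [w]. The hypotheses on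
    [b] and [c] leave decay rates [B / 2] and [1 / 2]; the integrals of [f], [g], [f2], [g2] are at
    most [4 / B], [4], [256 / B ^+ 3], [256], and [2048 = 2 * 256 * 4]. *)
Lemma chi2_moment_integral_le (a b c : R) :
  0 <= a -> `|b| <= (1 + a) / 2 -> `|c| <= 2^-1 ->
  (\int[nu]_z \int[nu]_w (chi2_moment (a * z) (b * z + c * w))%:E <=
   (1 + 2048 * local_norm2 a b c)%:E)%E.
Proof.
move=> a0 hb hc; set B := 1 + a; have B0 : 0 < B by rewrite /B; lra.
pose f (z : R) := expR (- (a * `|z|) + `|b| * `|z|).
pose g (w : R) := expR (`|c| * `|w|).
pose f2 (z : R) := z ^+ 2 * f z; pose g2 (w : R) := w ^+ 2 * g w.
have f0 z : 0 <= f z := expR_ge0 _; have g0 w : 0 <= g w := expR_ge0 _.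
have f20 z : 0 <= f2 z by rewrite mulr_ge0 ?sqr_ge0.
have g20 z : 0 <= g2 z by rewrite mulr_ge0 ?sqr_ge0.
have mn (k : R) : measurable_fun setT (fun z : R => k * `|z|).
  by apply: measurable_mulr_comp; exact: normr_measurable.
have mf : measurable_fun setT f.
  apply: measurable_expR_comp; apply: measurable_funD => //.
  exact: measurable_oppr_comp.
have mg : measurable_fun setT g by exact: measurable_expR_comp.
have mx2 : measurable_fun setT (fun z : R => z ^+ 2) by exact: measurable_funX.
have mf2 : measurable_fun setT f2 by exact: measurable_funM.
have mg2 : measurable_fun setT g2 by exact: measurable_funM.
have fle z : f z <= expR ((1 - B / 2) * `|z|).
  by rewrite ler_expR /B; have := normr_ge0 z; nra.
have gle z : g z <= expR ((1 - 2^-1) * `|z|).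
  by rewrite ler_expR; have := normr_ge0 z; nra.
have If : (\int[nu]_z (f z)%:E <= (2 * 1 / (B / 2))%:E)%E.
  apply: integral_normal_le_exp => //; first by rewrite divr_gt0.
  by move=> z; rewrite f0 mul1r fle.
have Ig : (\int[nu]_z (g z)%:E <= (2 * 1 / 2^-1)%:E)%E.
  by apply: integral_normal_le_exp => // z; rewrite g0 mul1r gle.
have If2 : (\int[nu]_z (f2 z)%:E <= (2 * (32 / B ^+ 2) / (B / 4))%:E)%E.
  apply: integral_normal_le_exp => //.
  - by rewrite divr_ge0// exprn_ge0// ltW.
  - by rewrite divr_gt0.
  move=> z; rewrite f20/=.
  apply: le_trans (ler_pM (sqr_ge0 _) (f0 z) (sqr_mul_exp_le z B0) (fle z)) _.
  rewrite -[leLHS]mulrA -expRD ler_wpM2l ?divr_ge0 ?exprn_ge0 ?(ltW B0)//.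
  by rewrite ler_expR; lra.
have Ig2 : (\int[nu]_z (g2 z)%:E <= (2 * 32 / 4^-1)%:E)%E.
  apply: integral_normal_le_exp => // z; rewrite g20/=.
  apply: le_trans (ler_pM (sqr_ge0 _) (g0 z) (sqr_mul_exp_le z ltr01) (gle z)) _.
  rewrite expr1n divr1 -[leLHS]mulrA -expRD ler_wpM2l// ler_expR.
  by have := normr_ge0 z; lra.
pose h (z w : R) := 1 + (2 * b ^+ 2 * (f2 z * g w) + 2 * c ^+ 2 * (f z * g2 w)).
have point z w : chi2_moment (a * z) (b * z + c * w) <= h z w.
  apply: le_trans (chi2_moment_le _ _) _; rewrite /h lerD2l.
  rewrite normrM (ger0_norm a0).
  have tri : `|b * z + c * w| <= `|b| * `|z| + `|c| * `|w|.
    by rewrite -!normrM ler_normD.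
  have e1 : expR (- (a * `|z|)) * expR `|b * z + c * w| <= f z * g w.
    by rewrite -expRD -expRD ler_expR; lra.
  have sq : (b * z + c * w) ^+ 2 <= 2 * b ^+ 2 * z ^+ 2 + 2 * c ^+ 2 * w ^+ 2.
    by have := sqr_ge0 (b * z - c * w); nra.
  rewrite mulrCA.
  apply: le_trans (ler_pM (sqr_ge0 _) _ sq e1) _; first by rewrite mulr_ge0 ?expR_ge0.
  by rewrite /f2 /g2 le_eqVlt; apply/orP; left; apply/eqP; ring.
have mc1 z : measurable_fun setT (fun w => (chi2_moment (a * z) (b * z + c * w))%:E).
  apply/measurable_EFinP.
  have mq : measurable_fun setT (fun w : R => (a * z, b * z + c * w)).
    by apply: measurable_fun_pair => //; apply: measurable_funD => //; exact: measurable_mulr_comp.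
  exact: (measurableT_comp measurable_chi2_moment mq).
have mc2 : measurable_fun setT (fun p : R * R => (chi2_moment (a * p.1) (b * p.1 + c * p.2))%:E).
  apply/measurable_EFinP.
  have mq : measurable_fun setT (fun p : R * R => (a * p.1, b * p.1 + c * p.2)).
    apply: measurable_fun_pair; first exact: measurable_mulr_comp.
    by apply: measurable_funD; exact: measurable_mulr_comp.
  exact: (measurableT_comp measurable_chi2_moment mq).
have k1 : 0 <= 2 * b ^+ 2 by rewrite mulr_ge0 ?sqr_ge0.
have k2 : 0 <= 2 * c ^+ 2 by rewrite mulr_ge0 ?sqr_ge0.
have inner z : (\int[nu]_w (chi2_moment (a * z) (b * z + c * w))%:E <=
    (1 + (2 * b ^+ 2 * (f2 z * 4) + 2 * c ^+ 2 * (f z * 256)))%:E)%E.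
  apply: (@le_trans _ _ (\int[nu]_w (1%:E + ((2 * b ^+ 2 * f2 z)%:E * (g w)%:E +
     (2 * c ^+ 2 * f z)%:E * (g2 w)%:E))))%E.
    apply: ge0_le_integral => //.
    - by move=> w _; rewrite lee_fin chi2_moment_ge0.
    - apply: emeasurable_funD => //; apply/measurable_EFinP.
      by apply: measurable_funD; exact: measurable_mulr_comp.
    - move=> w _; rewrite -!EFinM -!EFinD lee_fin.
      by apply: le_trans (point z w) _; rewrite /h !mulrA.
  have mg' : measurable_fun setT (fun w => (g w)%:E) by exact/measurable_EFinP.
  have mg2' : measurable_fun setT (fun w => (g2 w)%:E) by exact/measurable_EFinP.
  have z1 : 0 <= 2 * b ^+ 2 * f2 z by exact: mulr_ge0.
  have z2 : 0 <= 2 * c ^+ 2 * f z by exact: mulr_ge0.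
  rewrite ge0_integralD//; last 2 first.
  - by move=> w _; rewrite adde_ge0 ?mule_ge0 ?lee_fin.
  - by apply: emeasurable_funD; apply/measurable_EFinP; exact: measurable_mulr_comp.
  rewrite integral_probability_cst ge0_integralD//; last 4 first.
  - by move=> w _; rewrite mule_ge0 ?lee_fin.
  - by apply/measurable_EFinP; exact: measurable_mulr_comp.
  - by move=> w _; rewrite mule_ge0 ?lee_fin.
  - by apply/measurable_EFinP; exact: measurable_mulr_comp.
  rewrite ge0_integralZl//; last by move=> w _; rewrite lee_fin.
  rewrite ge0_integralZl//; last by move=> w _; rewrite lee_fin.
  rewrite !EFinD leeD2l// leeD//.
    apply: (le_trans (lee_wpmul2l _ Ig)); first by rewrite lee_fin.
    by rewrite -EFinM lee_fin; lra.
  apply: (le_trans (lee_wpmul2l _ Ig2)); first by rewrite lee_fin.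
  by rewrite -EFinM lee_fin; lra.
apply: (@le_trans _ _ (\int[nu]_z (1%:E + ((2 * b ^+ 2 * 4)%:E * (f2 z)%:E +
     (2 * c ^+ 2 * 256)%:E * (f z)%:E))))%E.
  apply: ge0_le_integral => //.
  - by move=> z _; apply: integral_ge0 => w _; rewrite lee_fin chi2_moment_ge0.
  - apply: (measurable_fun_fubini_tonelli_F (m2 := nu) _ mc2).
    by move=> p; rewrite lee_fin chi2_moment_ge0.
  - apply: emeasurable_funD => //; apply/measurable_EFinP.
    by apply: measurable_funD; exact: measurable_mulr_comp.
  - move=> z _; apply: le_trans (inner z) _.
    by rewrite -!EFinM -!EFinD lee_fin; lra.
have mf' : measurable_fun setT (fun w => (f w)%:E) by exact/measurable_EFinP.
have mf2' : measurable_fun setT (fun w => (f2 w)%:E) by exact/measurable_EFinP.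
have z1 : 0 <= 2 * b ^+ 2 * 4 := mulr_ge0 k1 (ler0n _ _).
have z2 : 0 <= 2 * c ^+ 2 * 256 := mulr_ge0 k2 (ler0n _ _).
rewrite ge0_integralD//; last 2 first.
- by move=> w _; rewrite adde_ge0 ?mule_ge0 ?lee_fin.
- by apply: emeasurable_funD; apply/measurable_EFinP; exact: measurable_mulr_comp.
rewrite integral_probability_cst ge0_integralD//; last 4 first.
- by move=> w _; rewrite mule_ge0 ?lee_fin.
- by apply/measurable_EFinP; exact: measurable_mulr_comp.
- by move=> w _; rewrite mule_ge0 ?lee_fin.
- by apply/measurable_EFinP; exact: measurable_mulr_comp.
rewrite ge0_integralZl//; last by move=> w _; rewrite lee_fin.
rewrite ge0_integralZl//; last by move=> w _; rewrite lee_fin.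
rewrite EFinD leeD2l//.
have -> : 2048 * local_norm2 a b c =
    2 * b ^+ 2 * 4 * (2 * (32 / B ^+ 2) / (B / 4)) + 2 * c ^+ 2 * 256 * (2 * 1 / (B / 2)).
  by rewrite /local_norm2 -/B; field; rewrite gt_eqF.
rewrite [leRHS]EFinD; apply: leeD.
  apply: (le_trans (lee_wpmul2l _ If2)); first by rewrite lee_fin.
  by rewrite -EFinM.
apply: (le_trans (lee_wpmul2l _ If)); first by rewrite lee_fin.
by rewrite -EFinM.
Qed.

(** Adding the gain on the left, instead of subtracting it on the right, keeps every integrand
    nonnegative. To be applied once in each of the two normal variables. *)
Lemma integral_add_indic_le d (T : measurableType d) (P : probability T R)
    (G : T -> \bar R) (q e : R) (I : set T) :
  measurable_fun setT G -> (forall x, (0 <= G x)%E) -> 0 <= q -> measurable I ->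
  (forall x, (G x + (q * \1_I x)%:E <= 1)%E) -> (e%:E <= P I)%E ->
  (\int[P]_x G x + (q * e)%:E <= 1)%E.
Proof.
move=> mG G0 q0 mI GI eI.
apply: (@le_trans _ _ (\int[P]_x (G x + q%:E * (\1_I x)%:E)))%E; last first.
  apply: (@le_trans _ _ (\int[P]_w 1%:E))%E; last by rewrite integral_probability_cst.
  apply: ge0_le_integral => //.
  - by move=> w _; rewrite adde_ge0 ?mule_ge0 ?lee_fin.
  - apply: emeasurable_funD => //; apply/measurable_EFinP.
    by apply: measurable_mulr_comp; exact: measurable_indic.
have mIE : measurable_fun setT (fun x => (\1_I x : R)%:E).
  exact/measurable_EFinP/measurable_indic.
rewrite ge0_integralD//; last 2 first.
- by move=> w _; rewrite mule_ge0 ?lee_fin.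
- by apply/measurable_EFinP; apply: measurable_mulr_comp; exact: measurable_indic.
rewrite leeD2l// ge0_integralZl//.
by rewrite integral_indic// setIT EFinM lee_wpmul2l ?lee_fin.
Qed.

(** The gain comes from the rectangle [I1] times [I2], where [|a z|] and [|b z + c w|] are at most
    1; elsewhere the affinity is bounded by 1. *)
Lemma hellinger_moment_integral_le (a b c : R) :
  0 <= a -> `|b| <= (1 + a) / 2 -> `|c| <= 2^-1 ->
  (\int[nu]_z \int[nu]_w (hellinger_moment (a * z) (b * z + c * w))%:E <=
   (1 - local_norm2 a b c / (512 * 512))%:E)%E.
Proof.
move=> a0 hb hc; set B := 1 + a; have B1 : 1 <= B by rewrite /B; lra.
have B0 : 0 < B by lra.
pose m := b ^+ 2 / (4 * B ^+ 2) + c ^+ 2 / 4.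
have m0 : 0 <= m by rewrite addr_ge0// divr_ge0 ?sqr_ge0// mulr_ge0// exprn_ge0// ltW.
(* The sign of [w] is chosen to make [b z] and [c w] agree in sign for [z >= 0]: the cross term of
   the square can then be dropped, which leaves [m]. *)
have [l [r [l1 r1 lr Iw]]] : exists l r : R, [/\ -1 <= l, r <= 1, r - l = 2^-1 &
    forall w, l <= w <= r -> [/\ 2^-1 <= `|w|, `|w| <= 1 & 0 <= b * c * w]].
  have [bc|/ltW bc] := leP 0 (b * c).
    exists 2^-1, 1; split; [lra|lra|lra|] => w /andP[w1 w2].
    have w0 : 0 <= w by lra.
    by rewrite ger0_norm//; split => //; exact: mulr_ge0.
  exists (-1), (- 2^-1); split; [lra|lra|lra|] => w /andP[w1 w2].
  have w0 : w <= 0 by lra.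
  by rewrite ler0_norm//; split; [lra|lra|exact: mulr_le0].
pose I1 := `[(2 * B)^-1, B^-1]%classic; pose I2 := `[l, r]%classic.
have Bi : (2 * B)^-1 = B^-1 / 2 by rewrite invfM mulrC.
have Bi0 : 0 < B^-1 by rewrite invr_gt0.
have Bi1 : B^-1 <= 1 by rewrite invf_le1.
have BB : B * B^-1 = 1 by rewrite divff// gt_eqF.
have [q q0 qE] : exists2 q : R, 0 <= q & q = m / 320.
  exists (m / 320); last by reflexivity.
  by apply: divr_ge0; [exact: m0|exact: ler0n].
have point z w : hellinger_moment (a * z) (b * z + c * w) +
    q * (\1_I1 z * \1_I2 w) <= 1.
  rewrite !indicE.
  have [zI|zI] := boolP (z \in I1); last by rewrite mul0r mulr0 addr0 hellinger_moment_le1.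
  have [wI|wI] := boolP (w \in I2); last by rewrite mulr0 mulr0 addr0 hellinger_moment_le1.
  rewrite !mulr1; move: zI wI; rewrite !inE /I1 /I2/= !in_itv/= Bi => /andP[z1 z2] /Iw[w1 w2 w3].
  have z0 : 0 <= z by lra.
  have g1 : `|a * z| <= 1.
    rewrite ger0_norm ?mulr_ge0//; apply: le_trans (ler_wpM2l a0 z2) _.
    by move: BB; rewrite /B; nra.
  have v1 : `|b * z + c * w| <= 1.
    apply: le_trans (ler_normD _ _) _; rewrite !normrM (ger0_norm z0).
    have h1 : `|b| * z <= B / 2 * B^-1 by apply: ler_pM.
    have h2 : `|c| * `|w| <= 2^-1 * 1 by apply: ler_pM.
    have : B / 2 * B^-1 = 2^-1 by rewrite mulrAC BB mul1r.
    lra.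
  apply: le_trans (lerD (hellinger_moment_le g1 v1) (lexx _)) _.
  suff : m <= (b * z + c * w) ^+ 2 by rewrite qE; lra.
  have zz : b ^+ 2 / (4 * B ^+ 2) <= (b * z) ^+ 2.
    rewrite exprMn ler_wpM2l ?sqr_ge0//.
    have -> : (4 * B ^+ 2)^-1 = (B^-1 / 2) ^+ 2 by field; rewrite gt_eqF.
    by rewrite lerXn2r ?nnegrE// ltW// divr_gt0.
  have ww : c ^+ 2 / 4 <= (c * w) ^+ 2.
    rewrite exprMn ler_wpM2l ?sqr_ge0// -(real_normK (num_real w)).
    have -> : 4^-1 = 2^-1 ^+ 2 :> R by field.
    by rewrite lerXn2r ?nnegrE// invr_ge0.
  have : 0 <= (b * c * w) * z by apply: mulr_ge0.
  rewrite /m; nra.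
have mI1 : measurable I1 by exact: measurable_itv.
have mI2 : measurable I2 by exact: measurable_itv.
have mh2 : measurable_fun setT (fun p : R * R => (hellinger_moment (a * p.1) (b * p.1 + c * p.2))%:E).
  apply/measurable_EFinP.
  have mq : measurable_fun setT (fun p : R * R => (a * p.1, b * p.1 + c * p.2)).
    apply: measurable_fun_pair; first exact: measurable_mulr_comp.
    by apply: measurable_funD; exact: measurable_mulr_comp.
  exact: (measurableT_comp measurable_hellinger_moment mq).
have mh1 z : measurable_fun setT (fun w => (hellinger_moment (a * z) (b * z + c * w))%:E).
  apply/measurable_EFinP.
  have mq : measurable_fun setT (fun w : R => (a * z, b * z + c * w)).
    by apply: measurable_fun_pair => //; apply: measurable_funD => //; exact: measurable_mulr_comp.
  exact: (measurableT_comp measurable_hellinger_moment mq).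
have H0 z : (0 <= \int[nu]_w (hellinger_moment (a * z) (b * z + c * w))%:E)%E.
  by apply: integral_ge0 => w _; rewrite lee_fin hellinger_moment_ge0.
have inner z : (\int[nu]_w (hellinger_moment (a * z) (b * z + c * w))%:E +
    (q / 12 * \1_I1 z)%:E <= 1)%E.
  have -> : q / 12 * \1_I1 z = q * \1_I1 z * (2^-1 / 6) by field.
  apply: (integral_add_indic_le (I := I2)) => //.
  - by move=> w; rewrite lee_fin hellinger_moment_ge0.
  - exact: mulr_ge0.
  - by move=> w; rewrite -EFinD lee_fin; have := point z w; rewrite mulrA.
  - by rewrite -lr; apply: std_normal_itv_ge => //; lra.
have tot : (\int[nu]_z \int[nu]_w (hellinger_moment (a * z) (b * z + c * w))%:E +
    (q / 12 * ((B^-1 - (2 * B)^-1) / 6))%:E <= 1)%E.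
  apply: (integral_add_indic_le (I := I1)) => //.
  - apply: (measurable_fun_fubini_tonelli_F (m2 := nu) _ mh2).
    by move=> p; rewrite lee_fin hellinger_moment_ge0.
  - by apply: divr_ge0; [exact: q0|exact: ler0n].
  - by apply: std_normal_itv_ge; rewrite ?Bi; lra.
(* The intervals [I2] and [I1] have probabilities at least [1 / 12] and [1 / (12 * B)]. Together
   with the 4 in [m] and the 320 in [q] this gives [4 * 320 * 144 = 320 * 576], afterwards rounded
   up to [512 * 512]. *)
have nE : q / 12 * ((B^-1 - (2 * B)^-1) / 6) = local_norm2 a b c / (320 * 576).
  by rewrite /local_norm2 qE /m -/B; field; rewrite gt_eqF.
have n0 : 0 <= local_norm2 a b c.
  by rewrite addr_ge0// divr_ge0 ?sqr_ge0 ?exprn_ge0// ltW.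
apply: (@le_trans _ _ (1 - local_norm2 a b c / (320 * 576))%:E).
  by rewrite EFinB leeBrDr// -nE.
by rewrite lee_fin lerD2l lerN2 ler_wpM2l// lef_pV2 ?posrE; lra.
Qed.
End Moments.

(** * Factorization of the likelihood *)

Section CondProb.
Context d (T : measurableType d) (R : realType) (P : probability T R).
Variable G : set (set T).
Hypothesis Gm : G `<=` measurable.

(** The model prescribes the conditional law of the label 1; this supplies the label -1. *)
Lemma is_cond_prob_setC (A : set T) (f : T -> R) : measurable A ->
  (forall w, 0 <= f w <= 1) ->
  is_cond_prob P G A f -> is_cond_prob P G (~` A) (fun w => 1 - f w).
Proof.
move=> mA f01 [fG fi fE].
have mf : measurable_fun setT f.
  by move=> _ B mB; rewrite setTI; apply: Gm; exact: fG.
have mf1 : measurable_fun setT (fun w => 1 - f w) by exact: measurable_funB.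
have f0 w : 0 <= f w by case/andP: (f01 w).
have f1 w : 0 <= 1 - f w by rewrite subr_ge0; case/andP: (f01 w).
split.
- move=> B mB.
  apply: (fG ((fun t => 1 - t) @^-1` B)).
  have : measurable_fun setT (fun t : R => 1 - t) by exact: measurable_funB.
  by move=> /(_ measurableT B mB); rewrite setTI.
- apply: (@le_integrable _ _ _ _ _ _ _ (cst 1%E)) => //.
  + exact/measurable_EFinP.
  + by move=> w _; rewrite /= lee_fin !ger0_norm// gerBl.
  + exact: finite_measure_integrable_cst.
move=> C GC; have mC := Gm GC.
have mfC : measurable_fun C (fun w => (f w)%:E) by exact/measurable_funTS/measurable_EFinP.
have mf1C : measurable_fun C (fun w => (1 - f w)%:E) by exact/measurable_funTS/measurable_EFinP.
have e1 : (\int[P]_(w in C) (1 - f w)%:E + \int[P]_(w in C) (f w)%:E = P C)%E.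
  rewrite -ge0_integralD//; last 2 first.
  - by move=> w _; rewrite lee_fin.
  - by move=> w _; rewrite lee_fin.
  under eq_integral do rewrite -EFinD subrK.
  by rewrite integral_cst// mul1e.
have e2 : (P (~` A `&` C) + P (A `&` C) = P C)%E.
  rewrite -measureU; first by rewrite -setIUl setvU setTI.
  - by apply: measurableI => //; exact: measurableC.
  - exact: measurableI.
  - by rewrite setIACA setICl set0I.
have fin : P (A `&` C) \is a fin_num by apply: fin_num_measure; exact: measurableI.
rewrite (fE C GC) in e1.
by rewrite -[LHS](addeK _ fin) e1 -e2 addeK.
Qed.
End CondProb.

Section Likelihood.
Context disp (T : measurableType disp) (R : realType) (P : probability T R).
Context {disp' : measure_display} {E : measurableType disp'} {n : nat}.
Variables (X : 'I_n -> {RV P >-> E}) (Y : 'I_n -> {RV P >-> R}).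

Definition sgn (b : bool) : R := if b then 1 else -1.

Variable p : bool -> E -> R.
Hypothesis mp : forall b, measurable_fun setT (p b).
Hypothesis p0 : forall b x, 0 <= p b x.
Hypothesis p1 : forall x, p true x + p false x = 1.
Hypothesis hX_indep : independent_family P (fun i w => X i w).
Hypothesis hY_val : forall i w, Y i w = 1 \/ Y i w = - 1.
Hypothesis hY_indep : cond_independent_family P
  (g_sigma_preimage (fun i w => X i w)) (fun i w => Y i w).
Hypothesis hY_law : forall i, is_cond_prob P (g_sigma_preimage (fun i w => X i w))
  [set w | Y i w = 1] (fun w => p true (X i w)).

Let Xt (w : T) : n.-tuple E := [tuple X i w | i < n].

Let mXt : measurable_fun setT Xt.
Proof.
apply/measurable_fun_tnthP => i.
have -> : (@tnth n E ^~ i) \o Xt = X i by apply/funext => w /=; rewrite tnth_mktuple.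
exact: measurable_funP.
Qed.

Let G := g_sigma_preimage (fun i w => X i w).

Let G_measurable : G `<=` measurable.
Proof.
apply: smallest_sub; first exact: sigma_algebra_measurable.
rewrite -bigcup_seq => B [i _ [A mA <-]].
exact: (measurable_funP (X i)).
Qed.

Let G_Xt D : measurable D -> G (Xt @^-1` D).
Proof.
move=> mD; rewrite /G.
have -> : (fun i w => X i w) = (fun i => (@tnth n E ^~ i) \o Xt).
  by apply/funext => i; apply/funext => w /=; rewrite tnth_mktuple.
by rewrite g_sigma_preimage_comp; exists D => //; rewrite setTI.
Qed.

Let mA (y : {ffun 'I_n -> bool}) : measurable [set w | forall i, Y i w = sgn (y i)].
Proof.
have -> : [set w | forall i, Y i w = sgn (y i)] =
    \big[setI/setT]_(i < n) (Y i @^-1` [set sgn (y i)]).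
  rewrite -bigcap_seq; apply/seteqP; split=> [w h i _|w h i]; first exact: h.
  by apply: h; rewrite /= mem_index_enum.
apply: bigsetI_measurable => i _; rewrite -[X in measurable X]setTI.
by apply: (measurable_funP (Y i)) => //; exact: measurable_set1.
Qed.

Let cond_sgn i b : is_cond_prob P G (Y i @^-1` [set sgn b]) (fun w => p b (X i w)).
Proof.
case: b; first exact: hY_law.
have pf x : p false x = 1 - p true x by rewrite -(p1 x) addrC addKr.
have -> : (fun w => p false (X i w)) = (fun w => 1 - p true (X i w)).
  by apply/funext => w; rewrite pf.
have -> : Y i @^-1` [set sgn false] = ~` [set w | Y i w = 1].
  apply/seteqP; split=> w /=; rewrite /sgn.
    by move=> -> e; lra.
  by case: (hY_val i w).
apply: is_cond_prob_setC => //.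
- rewrite -[X in measurable X]setTI.
  exact: (measurable_funP (Y i) measurableT _ (measurable_set1 1)).
- by move=> w; rewrite p0/= -subr_ge0 -pf p0.
Qed.

Let cond_all (y : {ffun 'I_n -> bool}) : is_cond_prob P G
  [set w | forall i, Y i w = sgn (y i)] (fun w => \prod_(i < n) p (y i) (X i w)).
Proof.
apply: (hY_indep (B := fun i => [set sgn (y i)]) (f := fun i w => p (y i) (X i w))).
  by move=> i; exact: measurable_set1.
by move=> i; exact: cond_sgn.
Qed.

(** Tower property: against a function of the design, the indicator of a label pattern may be
    replaced by its conditional probability. Equivalently, the law of the design under [P]
    restricted to the pattern has that probability as density. *)
Let integral_event (y : {ffun 'I_n -> bool}) (h : n.-tuple E -> R) :
  measurable_fun setT h -> (forall x, 0 <= h x) ->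
  (\int[P]_w (h (Xt w) * \1_[set w | forall i, Y i w = sgn (y i)] w)%:E =
   \int[P]_w (h (Xt w) * \prod_(i < n) p (y i) (X i w))%:E)%E.
Proof.
move=> mh h0; set A := [set w | _].
have mAy : measurable A := mA y.
have mhE : measurable_fun setT (fun x => (h x)%:E) by exact/measurable_EFinP.
have h0E x : (0 <= (h x)%:E)%E by rewrite lee_fin.
pose f (x : n.-tuple E) := \prod_(i < n) p (y i) (tnth x i).
have fX w : f (Xt w) = \prod_(i < n) p (y i) (X i w).
  by apply: eq_bigr => i _; rewrite tnth_mktuple.
have mf : measurable_fun setT f.
  apply: measurable_prod => i _; apply: measurableT_comp => //.
  exact: measurable_tnth.
have f0 x : 0 <= f x by apply: prodr_ge0.
pose m1 : {measure set T -> \bar R} := mrestr P mAy.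
pose XtF := mfun_pack mXt.
have e1 : (\int[m1]_w (h (Xt w))%:E = \int[P]_w ((h (Xt w))%:E * (\1_A w)%:E))%E.
  apply: ge0_integral_density => //.
  - by move=> B mB; rewrite integral_indic// setIC.
  - exact: (measurableT_comp mhE mXt).
have e2 : (\int[pushforward m1 XtF]_x (h x)%:E =
    \int[distribution P XtF]_x ((h x)%:E * (f x)%:E))%E.
  apply: ge0_integral_density => //.
  move=> D mD.
  have [_ _ /(_ _ (G_Xt mD)) e] := cond_all y.
  rewrite ge0_integral_pushforward//; last 2 first.
  - exact/measurable_funTS/measurable_EFinP.
  - by move=> x _; rewrite lee_fin.
  transitivity (P (A `&` Xt @^-1` D)).
    by rewrite [in RHS]setIC.
  by rewrite -e; apply: eq_integral => w _; rewrite -fX.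
under eq_integral do rewrite EFinM.
rewrite -e1.
under [RHS]eq_integral do rewrite EFinM -fX.
rewrite -[LHS](@ge0_integral_pushforward _ _ _ _ _ XtF (measurable_funP _) m1 setT (fun x => (h x)%:E))//.
rewrite e2 ge0_integral_distribution//.
- by apply: emeasurable_funM => //; exact/measurable_EFinP.
- by move=> x; rewrite mule_ge0// lee_fin.
Qed.

(** Expanding over the [2 ^ n] label patterns makes each term a function of the design times an
    indicator. Once the indicators are replaced by conditional probabilities, the sum factors again
    over the observations, and independence of the design finishes. *)
Lemma integral_likelihood (F : E -> R -> R) :
  (forall b, measurable_fun setT (fun x => F x (sgn b))) ->
  (forall x t, 0 <= F x t) ->
  (\int[P]_w (\prod_(i < n) F (X i w) (Y i w))%:E =
   \prod_(i < n) \int[distribution P (X i)]_x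
     (p true x * F x 1 + p false x * F x (-1))%:E)%E.
Proof.
move=> mF F0.
pose A (y : {ffun 'I_n -> bool}) := [set w | forall i, Y i w = sgn (y i)].
pose h (y : {ffun 'I_n -> bool}) (x : n.-tuple E) := \prod_(i < n) F (tnth x i) (sgn (y i)).
have mh y : measurable_fun setT (h y).
  apply: measurable_prod => i _.
  by apply: (measurableT_comp (mF (y i))); exact: measurable_tnth.
have h0 y x : 0 <= h y x by apply: prodr_ge0.
have hX y w : h y (Xt w) = \prod_(i < n) F (X i w) (sgn (y i)).
  by apply: eq_bigr => i _; rewrite tnth_mktuple.
have decomp w : \prod_(i < n) F (X i w) (Y i w) = \sum_(y : {ffun 'I_n -> bool})
    h y (Xt w) * \1_(A y) w.
  pose g i b := F (X i w) (sgn b) * (Y i w == sgn b)%:R.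
  have -> : \prod_(i < n) F (X i w) (Y i w) = \prod_(i < n) \sum_(b : bool) g i b.
    apply: eq_bigr => i _; rewrite big_bool /g /sgn/=.
    have n1 : (1 == -1 :> R) = false.
      by apply/negbTE/eqP => e; lra.
    case: (hY_val i w) => ->; rewrite eqxx ?n1 1?eq_sym ?n1 ?mulr1 ?mulr0 ?addr0 ?add0r//.
  rewrite bigA_distr_bigA/=; apply: eq_bigr => y _.
  rewrite /g big_split/= -hX; congr (_ * _).
  rewrite indicE; have [/set_mem Aw|nAw] := boolP (w \in A y).
    by rewrite big1// => i _; rewrite (Aw i) eqxx.
  have [i /eqP Yi] : exists i, Y i w <> sgn (y i).
    by apply/existsNP => H; move/negP: nAw; apply; exact: mem_set.
  by rewrite (bigD1 i)//= (negbTE Yi) mul0r.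
transitivity (\sum_(y : {ffun 'I_n -> bool}) \int[P]_w (h y (Xt w) * \1_(A y) w)%:E)%E.
  under eq_integral do rewrite decomp -sumEFin.
  rewrite ge0_integral_sum// => y.
  - apply/measurable_EFinP; apply: measurable_funM; last exact/measurable_indic/mA.
    exact: measurableT_comp.
  - by move=> w _; rewrite lee_fin mulr_ge0.
under eq_bigr do rewrite integral_event//.
pose H x := p true x * F x 1 + p false x * F x (-1).
have mH : measurable_fun setT H.
  by apply: measurable_funD; apply: measurable_funM => //; [exact: (mF true)|exact: (mF false)].
have H0 x : 0 <= H x by rewrite addr_ge0// mulr_ge0.
have mpX i b : measurable_fun setT (fun w => p b (X i w)) by exact: measurableT_comp.
transitivity (\int[P]_w (\prod_(i < n) H (tnth (Xt w) i))%:E)%E.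
  rewrite -ge0_integral_sum//; last 2 first.
  - move=> y; apply/measurable_EFinP; apply: measurable_funM; first exact: measurableT_comp.
    by apply: measurable_prod => i _.
  - by move=> y w _; rewrite lee_fin mulr_ge0// prodr_ge0.
  apply: eq_integral => w _; rewrite sumEFin; congr EFin.
  transitivity (\prod_(i < n) \sum_(b : bool) p b (X i w) * F (X i w) (sgn b)); last first.
    by apply: eq_bigr => i _; rewrite big_bool/= tnth_mktuple.
  rewrite bigA_distr_bigA; apply: eq_bigr => y _.
  by rewrite hX mulrC -big_split.
pose XtF := mfun_pack mXt.
have law : product_law (fun i => distribution P (X i)) (distribution P XtF).
  move=> B mB; rewrite -(hX_indep mB) /distribution /pushforward; congr (P _).
  by apply/seteqP; split=> w /= h' i; have := h' i; rewrite tnth_mktuple.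
rewrite -(product_law_integral_prod law) => //.
rewrite ge0_integral_distribution//.
- apply/measurable_EFinP; apply: measurable_prod => i _.
  by apply: (measurableT_comp mH); exact: measurable_tnth.
- by move=> x; rewrite lee_fin prodr_ge0// => i _; exact: H0.
Qed.
End Likelihood.

Section Tail.
Context d (T : measurableType d) (R : realType) (P : probability T R).

Lemma expR_markov (f : T -> R) (c x : R) : measurable_fun setT f ->
  (\int[P]_w (expR (f w))%:E <= (expR c)%:E)%E ->
  (P [set w | (x <= f w)%R] <= (expR (c - x))%:E)%E.
Proof.
move=> mf hf.
have mE : measurable [set w | (x <= f w)%R].
  rewrite (_ : [set w | _] = f @^-1` `[x, +oo[%classic).
    by rewrite -[X in measurable X]setTI; apply: mf => //; exact: measurable_itv.
  by apply/seteqP; split=> w /=; rewrite in_itv/= andbT.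
have me : measurable_fun setT (fun w => (expR (f w))%:E).
  by apply/measurable_EFinP; exact: measurableT_comp.
have : ((expR x)%:E * P [set w | (x <= f w)%R] <= (expR c)%:E)%E.
  apply: le_trans hf.
  have -> : ((expR x)%:E * P [set w | (x <= f w)%R] =
      \int[P]_w ((expR x)%:E * (\1_[set w | (x <= f w)%R] w)%:E))%E.
    rewrite ge0_integralZl//; last exact/measurable_EFinP/measurable_indic.
    by rewrite integral_indic// setIT.
  apply: ge0_le_integral => //.
  - apply: emeasurable_funM => //; apply/measurable_EFinP; exact: measurable_indic.
  - move=> w _; rewrite -EFinM lee_fin indicE.
    have [|_] := boolP (w \in _); last by rewrite mulr0 expR_ge0.
    by rewrite inE/= mulr1 ler_expR.
move=> h; rewrite expRD -(@lee_pmul2l _ (expR x)%:E)//; last by rewrite lte_fin expR_gt0.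
apply: le_trans h _; rewrite -EFinM lee_fin mulrCA expRxMexpNx_1 mulr1//.
Qed.
End Tail.

(** * The local quadratic form *)

Section Geometry.
Context {R : realType} {d : nat}.
Implicit Types (theta : d.-tuple R) (x w : 'I_d -> R).

Definition tsum theta w : d.-tuple R := [tuple tnth theta j + w j | j < d].

Definition ftuple w : d.-tuple R := [tuple w j | j < d].

Lemma inner_ftuple (z : d.-tuple R) w : inner z (ftuple w) = \sum_(j < d) tnth z j * w j.
Proof. by apply: eq_bigr => j _; rewrite tnth_mktuple. Qed.

Lemma inner_tsum (z : d.-tuple R) theta w :
  inner z (tsum theta w) = inner z theta + inner z (ftuple w).
Proof.
rewrite inner_ftuple /inner -big_split/=; apply: eq_bigr => j _.
by rewrite tnth_mktuple mulrDr.
Qed.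

Lemma tsumK theta (v : d.-tuple R) :
  tsum theta (fun j => tnth v j - tnth theta j) = v.
Proof. by apply: eq_from_tnth => j; rewrite tnth_mktuple addrC subrK. Qed.

Definition tnorm theta : R := Num.sqrt (inner theta theta).

Definition signal theta : R := 1 + tnorm theta.

(* The unit vector in the direction of [theta]; it is [0] when [theta = 0]. *)
Definition direction theta (j : 'I_d) : R := tnth theta j / tnorm theta.

Definition along theta w : R := \sum_(j < d) direction theta j * w j.

(* The squared Hellinger distance between the models at [theta] and at
   [theta + w] is comparable to this quadratic form as long as it is small. *)
Definition norm2 theta w : R :=
  (sqnorm w - (1 - (signal theta ^+ 2)^-1) * along theta w ^+ 2) / signal theta.

Lemma inner_ge0 theta : 0 <= inner theta theta.
Proof. by apply: sumr_ge0 => j _; rewrite -expr2 sqr_ge0. Qed.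

Lemma tnorm_ge0 theta : 0 <= tnorm theta. Proof. exact: sqrtr_ge0. Qed.

Lemma sqr_tnorm theta : tnorm theta ^+ 2 = inner theta theta.
Proof. by rewrite sqr_sqrtr// inner_ge0. Qed.

Lemma signal_gt0 theta : 0 < signal theta.
Proof. by rewrite /signal; have := tnorm_ge0 theta; lra. Qed.

Lemma local_norm2E theta w (a b c : R) : 0 <= a -> a ^+ 2 = inner theta theta ->
  a * b = inner theta (ftuple w) ->
  b ^+ 2 + c ^+ 2 = inner (ftuple w) (ftuple w) ->
  local_norm2 a b c = norm2 theta w.
Proof.
move=> a0 a2 ab bc.
have sa : tnorm theta = a by rewrite /tnorm -a2 sqrtr_sqr ger0_norm.
have ww : inner (ftuple w) (ftuple w) = sqnorm w.
  by apply: eq_bigr => j _; rewrite !tnth_mktuple expr2.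
rewrite ww in bc; rewrite /norm2 /local_norm2 /signal sa.
have aE : a * along theta w = a * b * (a * a^-1).
  rewrite ab inner_ftuple /along mulr_sumr mulr_suml; apply: eq_bigr => j _.
  by rewrite /direction sa; ring.
have [az|an] := eqVneq a 0.
  have al0 : along theta w = 0.
    by rewrite /along big1// => j _; rewrite /direction sa az invr0 mulr0 mul0r.
  by rewrite al0 az addr0 !expr1n !divr1 expr0n/= mulr0 subr0.
have -> : along theta w = b by apply: (mulfI an); rewrite aE divff// mulr1.
by rewrite -bc; field; rewrite gt_eqF//; lra.
Qed.

Lemma sum_mul_combination (y x e : 'I_d -> R) (g c : R) :
  \sum_(j < d) y j * (g * (x j + c * e j)) =
  g * (\sum_(j < d) y j * x j + c * \sum_(j < d) y j * e j).
Proof. by rewrite !mulr_sumr -big_split mulr_sumr; apply: eq_bigr => j _ /=; ring. Qed.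

Lemma sqnorm_combination (x e : 'I_d -> R) (g c : R) :
  sqnorm (fun j => g * (x j + c * e j)) =
  g ^+ 2 * (sqnorm x + 2 * c * (\sum_(j < d) e j * x j) + c ^+ 2 * sqnorm e).
Proof.
rewrite /sqnorm !mulr_sumr -!big_split mulr_sumr; apply: eq_bigr => j _ /=; ring.
Qed.

(** Stretches by [signal theta] along [theta], then scales by [gam]. For a suitable [gam] this turns
    [norm2 theta] into a multiple of [sqnorm], so the integer lattice can be used as it is. *)
Definition spread (gam : R) theta x (j : 'I_d) : R :=
  gam * (x j + (signal theta - 1) * along theta x * direction theta j).

(** The factor [signal theta - 1] lets the identity cover [theta = 0], where [direction theta]
    vanishes instead of being a unit vector. *)
Lemma direction_norm theta :
  (signal theta - 1) * sqnorm (direction theta) = signal theta - 1.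
Proof.
have -> : signal theta - 1 = tnorm theta by rewrite /signal; ring.
have [->|n0] := eqVneq (tnorm theta) 0; first by rewrite mul0r.
have -> : sqnorm (direction theta) = inner theta theta / tnorm theta ^+ 2.
  rewrite /inner mulr_suml; apply: eq_bigr => j _.
  by rewrite /direction; field.
by rewrite -sqr_tnorm divff ?mulr1// sqrf_eq0.
Qed.

Lemma along_combination (gam c : R) theta x :
  along theta (fun j => gam * (x j + c * direction theta j)) =
  gam * (along theta x + c * sqnorm (direction theta)).
Proof.
by rewrite {1}/along sum_mul_combination; congr (_ * (_ + _ * _)); apply: eq_bigr => j _; rewrite expr2.
Qed.

Lemma along_spread (gam : R) theta x :
  along theta (spread gam theta x) = gam * (signal theta * along theta x).
Proof.
rewrite along_combination mulrAC direction_norm; ring.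
Qed.

Lemma sqnorm_spread (gam : R) theta x : sqnorm (spread gam theta x) =
  gam ^+ 2 * (sqnorm x + (signal theta ^+ 2 - 1) * along theta x ^+ 2).
Proof.
rewrite sqnorm_combination -/(along theta x); congr (_ * _).
transitivity (sqnorm x + 2 * (signal theta - 1) * along theta x ^+ 2 +
  (signal theta - 1) * along theta x ^+ 2 *
  ((signal theta - 1) * sqnorm (direction theta))); first by ring.
by rewrite direction_norm; ring.
Qed.

Lemma norm2_spread (eta gam : R) theta x : gam ^+ 2 = eta * signal theta ->
  norm2 theta (spread gam theta x) = eta * sqnorm x.
Proof.
move=> gE; rewrite /norm2 along_spread sqnorm_spread exprMn exprMn gE.
have B0 : signal theta != 0 by rewrite gt_eqF// signal_gt0.
by move: (signal theta) B0 (sqnorm x) (along theta x) => B B0 s k; field.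
Qed.

Lemma spread_surj (gam : R) theta w : gam != 0 -> exists x, spread gam theta x = w.
Proof.
move=> g0; set B := signal theta; set k := along theta w.
have B0 : B != 0 by rewrite gt_eqF// signal_gt0.
(* This [c] divides the component along [theta] by [B], which the stretch restores. *)
pose c := - ((B - 1) / B * k).
exists (fun j => gam^-1 * (w j + c * direction theta j)).
have al : along theta (fun j => gam^-1 * (w j + c * direction theta j)) = gam^-1 * (k / B).
  rewrite along_combination -/k /c; congr (_ * _).
  transitivity (k - k / B * ((B - 1) * sqnorm (direction theta))); first by field.
  by rewrite direction_norm -/B; field.
apply/funext => j; rewrite /spread al -/B /c; field; rewrite g0 B0//.
Qed.

(** The coefficients on the right are the spread of [z], because [spread] is a symmetric linear
    map. *)
Lemma inner_spread (z : d.-tuple R) (gam : R) theta x :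
  inner z (ftuple (spread gam theta x)) =
  \sum_(j < d) gam * (tnth z j + (signal theta - 1) *
    (\sum_(l < d) tnth z l * direction theta l) * direction theta j) * x j.
Proof.
rewrite inner_ftuple sum_mul_combination.
transitivity (\sum_(j < d) x j * (gam * (tnth z j + (signal theta - 1) *
    (\sum_(l < d) tnth z l * direction theta l) * direction theta j))); last first.
  by apply: eq_bigr => j _; rewrite mulrC.
rewrite sum_mul_combination; congr (_ * (_ + _)).
  by apply: eq_bigr => j _; rewrite mulrC.
rewrite [RHS]mulrAC; congr (_ * _ * _).
by apply: eq_bigr => j _; rewrite mulrC.
Qed.
End Geometry.

(** * Moments of one observation under the Gaussian design *)

Section SingleMoments.
Context {R : realType} {d : nat}.
Variable mu : probability (d.-tuple R) R.
Hypothesis mu_gauss : product_law (fun=> std_normal) mu.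
Variables (theta : d.-tuple R) (w : 'I_d -> R).

Lemma half_moment_gauss :
  (\int[mu]_x (half_moment (inner x theta))%:E <= (1 + 4 / signal theta)%:E)%E.
Proof.
have [a [b [c [a0 a2 _ _ F]]]] := gaussian_pair_law theta theta mu_gauss.
have sa : tnorm theta = a by rewrite /tnorm -a2 sqrtr_sqr ger0_norm.
rewrite (F (fun p => (half_moment p.1)%:E)); last 2 first.
- apply/measurable_EFinP; apply: measurableT_comp; last exact: measurable_fst.
  exact: measurable_half_moment.
- by move=> p; rewrite lee_fin half_moment_ge0.
rewrite /=; under eq_integral do rewrite integral_probability_cst.
rewrite /signal sa; exact: half_moment_integral_le.
Qed.

Hypothesis w_small : norm2 theta w <= 1 / (4 * signal theta).

(** Each of the two nonnegative terms of [local_norm2] is at most [1 / (4 * (1 + a))]; this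
    threshold is the one that yields [b ^+ 2 <= (1 + a) ^+ 2 / 4] and [c ^+ 2 <= 1 / 4]. *)
Let coefficients (a b c : R) : 0 <= a -> a ^+ 2 = inner theta theta ->
  local_norm2 a b c = norm2 theta w -> `|b| <= (1 + a) / 2 /\ `|c| <= 2^-1.
Proof.
move=> a0 a2 N; have sa : tnorm theta = a by rewrite /tnorm -a2 sqrtr_sqr ger0_norm.
have ws := w_small; rewrite -N /local_norm2 /signal sa in ws.
set B := 1 + a in ws *; have B0 : 0 < B by rewrite /B; lra.
have bE : b ^+ 2 / B ^+ 3 * (4 * B ^+ 3) = 4 * b ^+ 2 by field; rewrite gt_eqF.
have cE : c ^+ 2 / B * (4 * B) = 4 * c ^+ 2 by field; rewrite gt_eqF.
have b0 : 0 <= b ^+ 2 / B ^+ 3 by rewrite divr_ge0 ?sqr_ge0// exprn_ge0// ltW.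
have c0 : 0 <= c ^+ 2 / B by rewrite divr_ge0 ?sqr_ge0// ltW.
split.
  have hb : b ^+ 2 / B ^+ 3 <= 1 / (4 * B) by lra.
  have : b ^+ 2 / B ^+ 3 * (4 * B ^+ 3) <= 1 / (4 * B) * (4 * B ^+ 3).
    by rewrite ler_wpM2r// mulr_ge0// exprn_ge0// ltW.
  have -> : 1 / (4 * B) * (4 * B ^+ 3) = B ^+ 2 by field; rewrite gt_eqF.
  rewrite bE => h; rewrite -(@ler_pXn2r _ 2)// ?nnegrE ?divr_ge0 ?(ltW B0)//.
  by rewrite real_normK ?num_real//; lra.
have hc : c ^+ 2 / B <= 1 / (4 * B) by lra.
have : c ^+ 2 / B * (4 * B) <= 1 / (4 * B) * (4 * B).
  by rewrite ler_wpM2r// mulr_ge0// ltW.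
rewrite divfK ?mulf_neq0 ?gt_eqF// cE => h.
rewrite -(@ler_pXn2r _ 2)// ?nnegrE ?invr_ge0// real_normK ?num_real//; lra.
Qed.

Lemma chi2_moment_gauss :
  (\int[mu]_x (chi2_moment (inner x theta) (inner x (ftuple w)))%:E <=
   (1 + 2048 * norm2 theta w)%:E)%E.
Proof.
have [a [b [c [a0 a2 ab bc F]]]] := gaussian_pair_law theta (ftuple w) mu_gauss.
have N := local_norm2E a0 a2 ab bc; have [hb hc] := coefficients a0 a2 N.
rewrite (F (fun p => (chi2_moment p.1 p.2)%:E)); last 2 first.
- by apply/measurable_EFinP; exact: measurable_chi2_moment.
- by move=> p; rewrite lee_fin chi2_moment_ge0.
by rewrite -N; exact: chi2_moment_integral_le.
Qed.

Lemma hellinger_moment_gauss :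
  (\int[mu]_x (hellinger_moment (inner x theta) (inner x (ftuple w)))%:E <=
   (1 - norm2 theta w / (512 * 512))%:E)%E.
Proof.
have [a [b [c [a0 a2 ab bc F]]]] := gaussian_pair_law theta (ftuple w) mu_gauss.
have N := local_norm2E a0 a2 ab bc; have [hb hc] := coefficients a0 a2 N.
rewrite (F (fun p => (hellinger_moment p.1 p.2)%:E)); last 2 first.
- by apply/measurable_EFinP; exact: measurable_hellinger_moment.
- by move=> p; rewrite lee_fin hellinger_moment_ge0.
by rewrite -N; exact: hellinger_moment_integral_le.
Qed.
End SingleMoments.

(** * The loss and its deviations *)

Section Loss.
Context {R : realType} {n d : nat}.
Variables (x : 'I_n -> d.-tuple R) (y : 'I_n -> R).

Definition loss (v : d.-tuple R) : R := \sum_(i < n) softplus (y i * inner (x i) v).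

Lemma loss_ge0 v : 0 <= loss v.
Proof. by apply: sumr_ge0 => i _; exact: softplus_ge0. Qed.

Lemma likelihoodE v : likelihood x y v = expR (- loss v).
Proof.
by rewrite /loss -sumrN expR_sum; apply: eq_bigr => i _; rewrite sigmoidE.
Qed.

(** Removes the supremum, which is positive and at most 1 but need not be attained. *)
Lemma log_likelihood_ratio_le (theta : d.-tuple R) (K : R) :
  log_likelihood_ratio x y theta <= K <-> forall v, loss theta - K <= loss v.
Proof.
set S := sup (range (likelihood x y)).
have ub : has_ubound (range (likelihood x y)).
  exists 1 => _ [v _ <-]; rewrite likelihoodE -expR0 ler_expR oppr_le0; exact: loss_ge0.
have le v : expR (- loss v) <= S.
  by rewrite -likelihoodE; apply: ub_le_sup => //; exists v.
have S0 : 0 < S := lt_le_trans (expR_gt0 _) (le theta).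
have -> : (log_likelihood_ratio x y theta <= K) = (S <= expR (K - loss theta)).
  rewrite /log_likelihood_ratio likelihoodE -/S -[in LHS](expRK K) ler_ln ?posrE ?expR_gt0//.
    by rewrite ler_pdivrMr ?expR_gt0// -expRD.
  by rewrite divr_gt0// expR_gt0.
split=> [h v|h].
  by have := le_trans (le v) h; rewrite ler_expR; lra.
apply: ge_sup => [|_ [v _ <-]]; first by exists (likelihood x y theta); exists theta.
by rewrite likelihoodE ler_expR; have := h v; lra.
Qed.

Lemma loss_lipschitz (e : R) (u v : d.-tuple R) :
  (forall j, `|tnth u j - tnth v j| <= e) ->
  loss v <= loss u + e * \sum_(i < n) \sum_(j < d) `|y i * tnth (x i) j|.
Proof.
move=> uv; rewrite /loss mulr_sumr -big_split/=; apply: ler_sum => i _.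
apply: le_trans (softplus_lipschitz (y i * inner (x i) u) _) _.
rewrite lerD2l -mulrBr -sumrB mulr_sumr mulr_sumr.
apply: le_trans (ler_norm_sum _ _ _) _; apply: ler_sum => j _.
by rewrite -mulrBr mulrA normrM mulrC ler_wpM2r.
Qed.

(** Rational parameters suffice by the Lipschitz bound; the event of the theorem thus becomes a
    countable intersection, hence measurable. *)
Lemma loss_ge_dense (c : R) :
  (forall q : {ffun 'I_d -> rat}, c <= loss (ftuple (fun j => ratr (q j)))) ->
  forall v, c <= loss v.
Proof.
move=> h v; rewrite leNgt; apply/negP => lt.
set M := \sum_(i < n) \sum_(j < d) `|y i * tnth (x i) j|.
have M0 : 0 <= M by apply: sumr_ge0 => i _; apply: sumr_ge0.
pose e := (c - loss v) / (M + 1).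
have e0 : 0 < e by rewrite divr_gt0 ?subr_gt0//; lra.
have ex j : exists q : rat, `|tnth v j - ratr q| <= e.
  have [q] := @rat_in_itvoo R (tnth v j - e) (tnth v j + e) ltac:(lra).
  by rewrite in_itv/= => /andP[? ?]; exists q; rewrite ler_norml; lra.
have [q hq] := choice ex.
have := @loss_lipschitz e v (ftuple (fun j => ratr ([ffun j => q j] j))).
have hq' j : `|tnth v j - tnth (ftuple (fun j => ratr ([ffun j => q j] j))) j| <= e.
  by rewrite tnth_mktuple ffunE.
move=> /(_ hq'); have := h [ffun j => q j]; rewrite -/M => h1 h2.
have : e * M < c - loss v.
  have <- : e * (M + 1) = c - loss v by rewrite /e divfK// gt_eqF//; lra.
  by rewrite ltr_pM2l//; lra.
lra.
Qed.

(** In the lattice coordinates each summand is [softplus] of an affine form, so the one-dimensional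
    subgradients combine by the chain rule. *)
Lemma loss_subgradients (theta : d.-tuple R) (gam c : R) :
  has_subgradients (fun k => loss (tsum theta (spread gam theta k)) + c).
Proof.
move=> m.
pose A i (j : 'I_d) := y i * (gam * (tnth (x i) j + (signal theta - 1) *
    (\sum_(l < d) tnth (x i) l * direction theta l) * direction theta j)).
have E i k : y i * inner (x i) (tsum theta (spread gam theta k)) =
    y i * inner (x i) theta + \sum_(j < d) A i j * k j.
  rewrite inner_tsum inner_spread mulrDr; congr (_ + _); rewrite mulr_sumr.
  by apply: eq_bigr => j _; rewrite /A mulrA.
pose s i := sigmoid (- (y i * inner (x i) theta + \sum_(j < d) A i j * m j)).
exists (fun j => - \sum_(i < n) s i * A i j) => k.
have -> : \sum_(j < d) (- \sum_(i < n) s i * A i j) * (k j - m j) =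
    - \sum_(i < n) s i * (\sum_(j < d) A i j * k j - \sum_(j < d) A i j * m j).
  rewrite -sumrN; under [RHS]eq_bigr => i _ do rewrite -sumrB mulr_sumr -sumrN.
  rewrite exchange_big/=; apply: eq_bigr => j _; rewrite mulNr mulr_suml -sumrN.
  by apply: eq_bigr => i _; ring.
rewrite addrAC lerD2r -sumrN -big_split/=; apply: ler_sum => i _.
rewrite !E; set b := y i * inner (x i) theta.
apply: le_trans (softplus_subgradient (b + \sum_(j < d) A i j * m j) _).
by rewrite -/(s i) opprD addrACA subrr add0r.
Qed.
End Loss.

(** * Union bound over the lattice points of a ball *)

Section LatticeUnionBound.
Context disp (T : measurableType disp) (R : realType) (P : probability T R).
Context {d : nat}.
Variables (f : T -> ('I_d -> R) -> R) (rho tau U L : R).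
Hypothesis mf : forall k, measurable_fun setT (f ^~ k).
Hypothesis f_subgradients : forall s, has_subgradients (f s).
Hypothesis f_zero : forall s, f s (fun=> 0) = 0.
Hypothesis rho3 : 3 <= rho.
Hypothesis rho40 : 12 * (3 * rho + 1) <= expR 40.
Hypothesis U0 : 0 <= U.
Hypothesis UL : U <= rho * L.

Let radius := 9 * rho ^+ 2 * d%:R.

Hypothesis upper : forall k, sqnorm k <= radius ->
  (P [set s | (U <= f s k)%R] <= (expR (- tau))%:E)%E.
Hypothesis lower : forall k, rho ^+ 2 / 3 * d%:R <= sqnorm k -> sqnorm k <= radius ->
  (P [set s | (f s k <= L)%R] <= (expR (- tau))%:E)%E.

(** A lattice point of the ball satisfies [|k j| <= k j ^+ 2 <= radius], so [m] bounds its
    coordinates. *)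
Let m := Num.truncn radius.

Let point (p : {ffun 'I_d -> bool * 'I_m.+1}) (j : 'I_d) : int :=
  if (p j).1 then (p j).2%:Z else - (p j).2%:Z.

Let real_point p (j : 'I_d) : R := (point p j)%:~R.

Let sqr_intr (a : int) : (a%:~R : R) ^+ 2 = (`|a|%N ^ 2)%:R.
Proof.
by rewrite -real_normK ?num_real// -intr_norm -abszE natrX.
Qed.

Let point_surj (k : 'I_d -> int) :
  sqnorm (fun j => (k j)%:~R : R) <= radius -> exists p, point p = k.
Proof.
move=> hk; exists [ffun j => (0 <= k j, inord `|k j|%N)]; apply/funext => j.
have kj : (`|k j| < m.+1)%N.
  rewrite ltnS truncn_ge_nat//; last first.
    by apply: le_trans hk; apply: sumr_ge0 => i _; exact: sqr_ge0.
  apply: (@le_trans _ _ (`|k j|%N ^ 2)%:R).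
    by rewrite ler_nat; case: `|k j|%N => // a; rewrite expnS expn1 leq_pmull.
  apply: le_trans hk; rewrite /sqnorm (bigD1 j)//= sqr_intr lerDl.
  by apply: sumr_ge0 => i _; exact: sqr_ge0.
rewrite /point ffunE/= inordK//.
by case: (leP 0 (k j)) => h; rewrite abszE; [rewrite ger0_norm|rewrite ltr0_norm// opprK].
Qed.

Let bad (q : bool * {ffun 'I_d -> bool * 'I_m.+1}) : set T :=
  if sqnorm (real_point q.2) <= radius then
    if q.1 then [set s | (U <= f s (real_point q.2))%R]
    else if rho ^+ 2 / 3 * d%:R <= sqnorm (real_point q.2) then
      [set s | (f s (real_point q.2) <= L)%R] else set0
  else set0.

Let measurable_bad q : measurable (bad q).
Proof.
rewrite /bad; case: ifP => // _; case: ifP => _; last case: ifP => // _.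
all: by rewrite -[X in measurable X]setTI; apply: measurable_fun_le.
Qed.

(** On the ball the squared coordinates sum to at most [(3 * rho) ^+ 2 * d], so the product is at
    least 1. It thus dominates a count of the lattice points while factoring over the
    coordinates. *)
Let bound (q : bool * {ffun 'I_d -> bool * 'I_m.+1}) :=
  expR (- tau) * \prod_(j < d) expR (1 - (q.2 j).2%:R ^+ 2 / (3 * rho) ^+ 2).

Let bad_le q : (P (bad q) <= (bound q)%:E)%E.
Proof.
have b0 : (0 <= (bound q)%:E)%E.
  by rewrite lee_fin mulr_ge0 ?expR_ge0// prodr_ge0// => j _; exact: expR_ge0.
rewrite /bad; case: ifP => hq; last by rewrite measure0.
apply: (@le_trans _ _ (expR (- tau))%:E).
  case: ifP => _; first exact: upper.
  by case: ifP => hq'; [exact: lower|rewrite measure0 lee_fin expR_ge0].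
rewrite lee_fin /bound ler_peMr ?expR_ge0// -expR_sum -[leLHS]expR0 ler_expR.
rewrite sumrB sumr_const card_ord -mulr_suml.
have -> : \sum_(j < d) (q.2 j).2%:R ^+ 2 = sqnorm (real_point q.2).
  apply: eq_bigr => j _; rewrite /real_point /point; case: ifP => _.
    by rewrite -pmulrn.
  by rewrite rmorphN/= sqrrN -pmulrn.
have r3 := rho3; rewrite subr_ge0 ler_pdivrMr; last by rewrite exprn_gt0//; lra.
by move: hq; rewrite /radius exprMn; lra.
Qed.

Let sum_bound : \sum_q bound q <= 2 * expR (41 * d%:R - tau).
Proof.
have S : \sum_(p : {ffun 'I_d -> bool * 'I_m.+1})
    \prod_(j < d) expR (1 - (p j).2%:R ^+ 2 / (3 * rho) ^+ 2) <= expR (41 * d%:R) :> R.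
  rewrite -(bigA_distr_bigA (fun j (p : bool * 'I_m.+1) => expR (1 - p.2%:R ^+ 2 / (3 * rho) ^+ 2)))/=.
  rewrite prodr_const card_ord expRM_natr lerXn2r ?nnegrE ?expR_ge0//.
    by apply: sumr_ge0 => p _; exact: expR_ge0.
  under eq_bigr do rewrite expRD.
  (* Per coordinate, [exp 1] comes from the 1 in the exponent of [bound], and [exp 40] from the
     one-dimensional Gaussian sum. *)
  have -> : 41 = 1 + 40 :> R by ring.
  rewrite -mulr_sumr expRD ler_pM2l ?expR_gt0//.
  by have r3 := rho3; apply: le_trans (sum_expR_sqr_le _ _) rho40; lra.
rewrite (eq_bigr (fun q => (fun (b : bool) (p : {ffun 'I_d -> bool * 'I_m.+1}) => expR (- tau) *
  \prod_(j < d) expR (1 - (p j).2%:R ^+ 2 / (3 * rho) ^+ 2)) q.1 q.2))//.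
rewrite -(pair_bigA _ (fun (b : bool) (p : {ffun 'I_d -> bool * 'I_m.+1}) => expR (- tau) *
  \prod_(j < d) expR (1 - (p j).2%:R ^+ 2 / (3 * rho) ^+ 2)))/=.
rewrite big_bool/= -mulr_sumr [41 * _ - _]addrC expRD.
have := ler_wpM2l (expR_ge0 (- tau)) S; lra.
Qed.

Lemma lattice_union_bound : exists B, [/\ measurable B,
  (P B <= (2 * expR (41 * d%:R - tau))%:E)%E & forall s, ~ B s -> forall x, - U <= f s x].
Proof.
exists (\big[setU/set0]_q bad q); split.
- exact: bigsetU_measurable.
- apply: (@le_trans _ _ (\sum_q (bound q)%:E)%E); last by rewrite sumEFin lee_fin; exact: sum_bound.
  suff : measurable (\big[setU/set0]_q bad q) /\
      (P (\big[setU/set0]_q bad q) <= \sum_q (bound q)%:E)%E by case.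
  elim/big_ind2 : _ => [|a A b B [mA hA] [mB hB]|q _]; first by rewrite measure0.
    split; first exact: measurableU.
    apply: le_trans (measureU2 _ mA mB) _; exact: leeD.
  by split.
move=> s; rewrite -bigcup_seq => nb.
have good q : ~ bad q s by move=> bq; apply: nb; exists q => //=; rewrite mem_index_enum.
apply: (lattice_lower_bound (f_subgradients s) (f_zero s) rho3 U0 UL) => [k hk|k hk1 hk2].
  have [p pE] := point_surj hk; rewrite leNgt; apply/negP => lt.
  apply: (good (true, p)); rewrite /bad /real_point /= pE hk /=; exact: ltW.
have [p pE] := point_surj hk2; rewrite leNgt; apply/negP => lt.
by apply: (good (false, p)); rewrite /bad /real_point /= pE hk2 hk1 /=; exact: ltW.
Qed.
End LatticeUnionBound.

(** * Tail bounds for the loss and the two sample-size regimes *)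

Section Events.
Context disp (T : measurableType disp) (R : realType) (P : probability T R).
Context {n d : nat}.
Variables (X : 'I_n -> {RV P >-> d.-tuple R}) (Y : 'I_n -> {RV P >-> R}).

Let lossXY w v := loss (fun i => X i w) (fun i => Y i w) v.

Lemma measurable_loss v : measurable_fun setT (lossXY ^~ v).
Proof.
apply: measurable_sum => i; apply: measurableT_comp; first exact: measurable_softplus.
apply: measurable_funM; first exact: measurable_funP.
exact: (measurableT_comp (measurable_inner v) (measurable_funP (X i))).
Qed.

Lemma measurable_log_likelihood_ratio_le theta (K : R) : measurable
  [set w | log_likelihood_ratio (fun i => X i w) (fun i => Y i w) theta <= K].
Proof.
have -> : [set w | log_likelihood_ratio (fun i => X i w) (fun i => Y i w) theta <= K] =
    ~` \bigcup_(q : {ffun 'I_d -> rat})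
      ~` [set w | lossXY w theta - K <= lossXY w (ftuple (fun j => ratr (q j)))].
  rewrite setC_bigcup; apply/seteqP; split=> [w /= /log_likelihood_ratio_le h q _|w h /=].
    by rewrite setCK; exact: h.
  apply/log_likelihood_ratio_le; apply: loss_ge_dense => q.
  by have := h q I; rewrite setCK.
apply: measurableC; apply: countable_bigcupT_measurable; first exact: countableP.
move=> q; apply: measurableC; rewrite -[X in measurable X]setTI.
apply: measurable_fun_le => //; last exact: measurable_loss.
by apply: measurable_funB => //; exact: measurable_loss.
Qed.

Hypothesis hX_indep : independent_family P (fun i w => X i w).
Hypothesis hX_law : forall i, std_gaussian (distribution P (X i)).
Hypothesis hY_val : forall i w, Y i w = 1 \/ Y i w = - 1.
Hypothesis hY_indep : cond_independent_family P
  (g_sigma_preimage (fun i w => X i w)) (fun i w => Y i w).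
Variable theta : d.-tuple R.
Hypothesis hY_law : forall i, is_cond_prob P (g_sigma_preimage (fun i w => X i w))
  [set w | Y i w = 1] (fun w => sigmoid (inner (X i w) theta)).

Let p (b : bool) (z : d.-tuple R) := expR (- softplus (sgn R b * inner z theta)).

Let integral_likelihood_le (F : d.-tuple R -> R -> R) (r : R) :
  (forall b, measurable_fun setT (fun z => F z (sgn R b))) ->
  (forall z t, 0 <= F z t) ->
  (forall i, (\int[distribution P (X i)]_z
     (p true z * F z 1 + p false z * F z (-1))%:E <= (1 + r)%:E)%E) ->
  (\int[P]_w (\prod_(i < n) F (X i w) (Y i w))%:E <= (expR (n%:R * r))%:E)%E.
Proof.
move=> mF F0 hF; rewrite (integral_likelihood (p := p)) => //; last 4 first.
- move=> b; apply: measurable_expR_comp; apply: measurable_oppr_comp.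
  apply: measurableT_comp; first exact: measurable_softplus.
  by apply: measurable_mulr_comp; exact: measurable_inner.
- by move=> b z; exact: expR_ge0.
- by move=> z; rewrite /p /= mul1r mulN1r -!sigmoidE sigmoidDN.
- move=> i; have -> : (fun w => p true (X i w)) = (fun w => sigmoid (inner (X i w) theta)).
    by apply/funext => w; rewrite /p /= mul1r sigmoidE.
  exact: hY_law.
have -> : (expR (n%:R * r))%:E = (\prod_(i < n) (expR r)%:E)%E.
  by rewrite prodEFin prodr_const card_ord expRM_natl.
suff : (0 <= \prod_(i < n) \int[distribution P (X i)]_z
    (p true z * F z 1 + p false z * F z (-1))%:E <= \prod_(i < n) (expR r)%:E)%E.
  by case/andP.
apply: (big_ind2 (fun a b : \bar R => (0 <= a <= b)%E)); first by rewrite lexx lee01.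
  move=> a b a' b' /andP[a0 ab] /andP[a0' ab']; rewrite mule_ge0//=.
  exact: lee_pmul.
move=> i _; apply/andP; split.
  by apply: integral_ge0 => z _; rewrite lee_fin addr_ge0// mulr_ge0// expR_ge0.
by apply: le_trans (hF i) _; rewrite lee_fin expR_ge1Dx.
Qed.

Let X_gauss i : product_law (fun=> std_normal) (distribution P (X i)).
Proof. exact: hX_law. Qed.

Let diff_mfun w : measurable_fun setT
  (fun s => lossXY s (tsum theta w) - lossXY s theta).
Proof. by apply: measurable_funB; exact: measurable_loss. Qed.

Let expR_lossB (c : R) s w : expR (c * (lossXY s (tsum theta w) - lossXY s theta)) =
  \prod_(i < n) expR (c * (softplus (Y i s * (inner (X i s) theta + inner (X i s) (ftuple w))) -
    softplus (Y i s * inner (X i s) theta))).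
Proof.
rewrite /lossXY /loss -sumrB mulr_sumr expR_sum; apply: eq_bigr => i _.
by rewrite inner_tsum.
Qed.

Let measurable_factor (c : R) w b : measurable_fun setT (fun z : d.-tuple R =>
  expR (c * (softplus (sgn R b * (inner z theta + inner z (ftuple w))) -
    softplus (sgn R b * inner z theta)))).
Proof.
apply: measurable_expR_comp; apply: measurable_mulr_comp; apply: measurable_funB.
  apply: measurableT_comp; first exact: measurable_softplus.
  by apply: measurable_mulr_comp; apply: measurable_funD; exact: measurable_inner.
apply: measurableT_comp; first exact: measurable_softplus.
by apply: measurable_mulr_comp; exact: measurable_inner.
Qed.

Lemma loss_upper_tail w (U : R) : norm2 theta w <= 1 / (4 * signal theta) ->
  (P [set s | (U <= lossXY s (tsum theta w) - lossXY s theta)%R] <=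
   (expR (n%:R * (2048 * norm2 theta w) - U))%:E)%E.
Proof.
move=> hw; apply: expR_markov => //.
under eq_integral do rewrite -[_ - _]mul1r expR_lossB.
apply: (integral_likelihood_le (F := fun z t =>
  expR (1 * (softplus (t * (inner z theta + inner z (ftuple w))) - softplus (t * inner z theta))))).
- exact: measurable_factor.
- by move=> z t; exact: expR_ge0.
move=> i; apply: le_trans (chi2_moment_gauss (X_gauss i) hw); rewrite le_eqVlt; apply/orP; left; apply/eqP.
by apply: eq_integral => z _; rewrite /p /chi2_moment /= !mul1r !mulN1r.
Qed.

Lemma loss_lower_tail w (L : R) : norm2 theta w <= 1 / (4 * signal theta) ->
  (P [set s | (lossXY s (tsum theta w) - lossXY s theta <= L)%R] <=
   (expR (L / 2 - n%:R * (norm2 theta w / (512 * 512))))%:E)%E.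
Proof.
move=> hw.
have -> : [set s | lossXY s (tsum theta w) - lossXY s theta <= L] =
    [set s | - (L / 2) <= - 2^-1 * (lossXY s (tsum theta w) - lossXY s theta)].
  by apply/seteqP; split=> s /=; lra.
have -> : L / 2 - n%:R * (norm2 theta w / (512 * 512)) =
    n%:R * - (norm2 theta w / (512 * 512)) - - (L / 2) by ring.
apply: expR_markov; first exact: measurable_mulr_comp.
under eq_integral do rewrite expR_lossB.
apply: (integral_likelihood_le (F := fun z t =>
  expR (- 2^-1 * (softplus (t * (inner z theta + inner z (ftuple w))) - softplus (t * inner z theta))))).
- exact: measurable_factor.
- by move=> z t; exact: expR_ge0.
move=> i; apply: le_trans (hellinger_moment_gauss (X_gauss i) hw); rewrite le_eqVlt; apply/orP; left; apply/eqP.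
by apply: eq_integral => z _; rewrite /p /hellinger_moment /= !mul1r !mulN1r.
Qed.

Lemma half_loss_tail (u : R) :
  (P [set s | (u <= 2^-1 * lossXY s theta)%R] <=
   (expR (n%:R * (4 / signal theta) - u))%:E)%E.
Proof.
apply: expR_markov; first by apply: measurable_mulr_comp; exact: measurable_loss.
have E s : expR (2^-1 * lossXY s theta) =
    \prod_(i < n) expR (2^-1 * softplus (Y i s * inner (X i s) theta)).
  by rewrite /lossXY /loss mulr_sumr expR_sum.
under eq_integral do rewrite E.
apply: (integral_likelihood_le (F := fun z t => expR (2^-1 * softplus (t * inner z theta)))).
- move=> b; apply: measurable_expR_comp; apply: measurable_mulr_comp.
  apply: measurableT_comp; first exact: measurable_softplus.
  by apply: measurable_mulr_comp; exact: measurable_inner.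
- by move=> z t; exact: expR_ge0.
move=> i; apply: le_trans (half_moment_gauss (X_gauss i) theta); rewrite le_eqVlt; apply/orP; left; apply/eqP.
by apply: eq_integral => z _; rewrite /p /half_moment /= !mul1r !mulN1r.
Qed.

Lemma small_sample (u : R) :
  (1 - (expR (- u))%:E <= P [set s | (log_likelihood_ratio (fun i => X i s) (fun i => Y i s) theta
    <= 8 * (n%:R / signal theta) + 2 * u)%R])%E.
Proof.
set E := [set s | _]; have mE : measurable E := measurable_log_likelihood_ratio_le _ _.
set K := _ + 2 * u in E mE *.
rewrite leeBlDr// -leeBlDl// ?fin_num_measure// -probability_setC//.
(* [K / 2] is [u] plus the exponent [4 n / signal theta] of the moment of half the loss. *)
apply: (@le_trans _ _ (P [set s | (K / 2 <= 2^-1 * lossXY s theta)%R])).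
  apply: le_measure; rewrite ?inE; first exact: measurableC.
    rewrite -[X in measurable X]setTI; apply: measurable_fun_le => //.
    by apply: measurable_mulr_comp; exact: measurable_loss.
  move=> s /= nE; rewrite leNgt; apply/negP => lt; apply: nE => /=.
  apply/log_likelihood_ratio_le => v; apply: (@le_trans _ _ 0); last exact: loss_ge0.
  by rewrite -/(lossXY s theta); lra.
apply: le_trans (half_loss_tail _) _; rewrite lee_fin ler_expR /K.
by rewrite le_eqVlt; apply/orP; left; apply/eqP; field; rewrite gt_eqF// signal_gt0.
Qed.

(** [Q] is the value of [n * norm2] at lattice radius [rho sqrt d]. On the whole lattice ball this
    value is at most [9 * Q]: then [36 * Q * signal theta <= n] keeps [norm2] below its threshold,
    and [U] exceeds the chi-square exponent [9 * (2048 * Q)] by at least [Q >= tau]. From radius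
    [rho sqrt (d / 3)] on, the Hellinger exponent is at least [Q / 3 / (512 * 512)], which pays for
    [L / 2 + tau]. *)
Lemma large_sample (rho tau Q U L : R) : (0 < n)%N -> (0 < d)%N ->
  3 <= rho -> 12 * (3 * rho + 1) <= expR 40 -> 0 < Q -> tau <= Q ->
  9 * (2048 * Q) + Q <= U -> U <= rho * L -> L / 2 + tau <= Q / 3 / (512 * 512) ->
  36 * Q * signal theta <= n%:R ->
  (1 - (2 * expR (41 * d%:R - tau))%:E <= P [set s |
    (log_likelihood_ratio (fun i => X i s) (fun i => Y i s) theta <= U)%R])%E.
Proof.
move=> n0 d0 rho3 rho40 Q0 tauQ QU UL LQ nQ.
have lower_exponent (b : R) : Q / 3 <= b -> L / 2 - b / (512 * 512) <= - tau.
  by move=> ?; lra.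
have nR : 0 < n%:R :> R by rewrite ltr0n.
have dR : 0 < d%:R :> R by rewrite ltr0n.
have B0 := signal_gt0 theta.
have rho2 : 0 < rho ^+ 2 by rewrite exprn_gt0//; lra.
pose eta := Q / (n%:R * (rho ^+ 2 * d%:R)).
have eta0 : 0 < eta by apply: divr_gt0 => //; apply: mulr_gt0 => //; exact: mulr_gt0.
have es0 : 0 < eta * signal theta by rewrite mulr_gt0.
pose gam := Num.sqrt (eta * signal theta).
have g0 : gam != 0 by rewrite gt_eqF// sqrtr_gt0.
have norm2E k : norm2 theta (spread gam theta k) = eta * sqnorm k.
  by apply: norm2_spread; rewrite sqr_sqrtr// ltW.
have n_eta (k : 'I_d -> R) : n%:R * (eta * sqnorm k) = Q * (sqnorm k / (rho ^+ 2 * d%:R)).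
  by rewrite /eta; field; rewrite !gt_eqF//; lra.
have small (k : 'I_d -> R) : sqnorm k <= 9 * rho ^+ 2 * d%:R -> n%:R * (eta * sqnorm k) <= 9 * Q.
  move=> hk; rewrite n_eta mulrC ler_pM2r// ler_pdivrMr ?mulr_gt0//; lra.
have norm2_small k : sqnorm k <= 9 * rho ^+ 2 * d%:R ->
    norm2 theta (spread gam theta k) <= 1 / (4 * signal theta).
  move=> hk; rewrite norm2E -(@ler_pM2l _ n%:R)//; apply: le_trans (small _ hk) _.
  by rewrite mulrA mulr1 ler_pdivlMr ?mulr_gt0//; lra.
pose f s k := lossXY s (tsum theta (spread gam theta k)) - lossXY s theta.
have mf k : measurable_fun setT (f ^~ k).
  by apply: measurable_funB; exact: measurable_loss.
have fG s : has_subgradients (f s) by exact: loss_subgradients.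
have f0 s : f s (fun=> 0) = 0.
  rewrite /f; suff -> : tsum theta (spread gam theta (fun=> 0)) = theta by rewrite subrr.
  apply: eq_from_tnth => j; rewrite tnth_mktuple /spread /along big1 => [|l _].
    by rewrite mulr0 mul0r addr0 mulr0 addr0.
  by rewrite mulr0.
have U0 : 0 <= U by apply: le_trans QU; lra.
have upper k : sqnorm k <= 9 * rho ^+ 2 * d%:R ->
    (P [set s | (U <= f s k)%R] <= (expR (- tau))%:E)%E.
  move=> hk; apply: le_trans (loss_upper_tail _ (norm2_small _ hk)) _.
  rewrite lee_fin ler_expR norm2E mulrCA.
  have := small _ hk; move: (n%:R * _) => a; lra.
have lower k : rho ^+ 2 / 3 * d%:R <= sqnorm k -> sqnorm k <= 9 * rho ^+ 2 * d%:R ->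
    (P [set s | (f s k <= L)%R] <= (expR (- tau))%:E)%E.
  move=> hk1 hk2; apply: le_trans (loss_lower_tail _ (norm2_small _ hk2)) _.
  rewrite lee_fin ler_expR norm2E mulrA n_eta.
  have : 3^-1 <= sqnorm k / (rho ^+ 2 * d%:R) by rewrite ler_pdivlMr ?mulr_gt0//; lra.
  move=> /(ler_wpM2l (ltW Q0)) h.
  exact: lower_exponent h.
have [B [mB PB good]] := lattice_union_bound mf fG f0 rho3 rho40 U0 UL upper lower.
set E := [set s | _]; have mE : measurable E := measurable_log_likelihood_ratio_le _ _.
rewrite leeBlDr// -leeBlDl// ?fin_num_measure// -probability_setC//.
apply: le_trans PB; apply: le_measure; rewrite ?inE//; first exact: measurableC.
move=> s /= nE; apply: contrapT => nb; apply: nE.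
apply/log_likelihood_ratio_le => v.
have [x hx] := spread_surj theta (fun j => tnth v j - tnth theta j) g0.
by have := good s nb x; rewrite /f hx tsumK /lossXY; lra.
Qed.

End Events.

Theorem theorem3p1 (R : realType) (disp : measure_display)
    (T : measurableType disp) (P : probability T R) (n d : nat)
    (hn : (1 <= n)%N) (hd : (1 <= d)%N)
    (X : 'I_n -> {RV P >-> d.-tuple R}) (Y : 'I_n -> {RV P >-> R})
    (theta_star : d.-tuple R)
    (hX_indep : independent_family P (fun i w => X i w))
    (hX_law : forall i, std_gaussian (distribution P (X i)))
    (hY_val : forall i w, Y i w = 1 \/ Y i w = - 1)
    (hY_indep : cond_independent_family P (g_sigma_preimage (fun i w => X i w))
                  (fun i w => Y i w))
    (hY_law : forall i, is_cond_prob P (g_sigma_preimage (fun i w => X i w))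
                  [set w | Y i w = 1]
                  (fun w => sigmoid (inner (X i w) theta_star)))
    (delta : R) (hdelta0 : 0 < delta) (hdelta1 : delta < 1) :
  ((1 - delta)%:E <=
   P [set w | (log_likelihood_ratio (fun i => X i w) (fun i => Y i w) theta_star
               <= 4 * 10 ^+ 13 * (d%:R + ln (5 / delta)))%R])%E.
Proof.
have B0 := signal_gt0 theta_star.
set t := ln (5 / delta).
have t0 : 0 < t.
  by rewrite ln_gt0// ltr_pdivlMr// mul1r; lra.
have et : expR (- t) = delta / 5.
  by rewrite expRN lnK ?invf_div// posrE divr_gt0.
have d1 : 1 <= d%:R :> R by rewrite ler1n.
set K := 4 * 10 ^+ 13 * (d%:R + t).
set E := [set w | _]; have mE : measurable E by exact: measurable_log_likelihood_ratio_le.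
(* After the lattice has consumed [41 d], a failure probability [2 * expR (- t) = 2 * delta / 5] is
   left. *)
pose tau := 41 * d%:R + t.
(* With [L = 2 * tau], this makes [L / 2 + tau] equal to [Q / 3 / (512 * 512)]. *)
pose Q := 6 * (512 * 512) * tau.
have tau0 : 0 < tau by rewrite /tau; lra.
have [nQ|nQ] := leP (36 * Q * signal theta_star) n%:R.
  apply: (@le_trans _ _ (1 - (2 * expR (41 * d%:R - tau))%:E)%E).
    rewrite -EFinB lee_fin (_ : 41 * d%:R - tau = - t); last by rewrite /tau; ring.
    by rewrite et; lra.
  (* The choice [rho = 2 * 10 ^+ 10] lies above [U / L = (9 * 2048 + 1) * 3 * 512 ^ 2], about
     [1.45 * 10 ^ 10], and below about [3 * 10 ^ 10], the largest value allowed with [2 ^ 40] in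
     place of [exp 40]. *)
  have e40 : 12 * (3 * (2 * 10 ^+ 10) + 1) <= expR 40 :> R.
    apply: (@le_trans _ _ (2 ^+ 40)); first by lra.
    have -> : 40 = 1 * 40%:R :> R by rewrite mul1r.
    rewrite expRM_natr lerXn2r ?nnegrE ?expR_ge0//.
    by have := expR_ge1Dx (1 : R); lra.
  have Q0 : 0 < Q by rewrite /Q; lra.
  have tauQ : tau <= Q by rewrite /Q; lra.
  have rho3 : 3 <= 2 * 10 ^+ 10 :> R by lra.
  have UL : 9 * (2048 * Q) + Q <= 2 * 10 ^+ 10 * (2 * tau) by rewrite /Q; lra.
  have LQ : 2 * tau / 2 + tau <= Q / 3 / (512 * 512) by rewrite /Q; lra.
  apply: le_trans (large_sample hX_indep hX_law hY_val hY_indep hY_law hn hd rho3 e40 Q0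
    tauQ (lexx _) UL LQ nQ) _.
  apply: le_measure; rewrite ?inE//; first exact: measurable_log_likelihood_ratio_le.
  by move=> w /= /le_trans; apply; rewrite /K /Q /tau; lra.
(* Here [n / signal theta_star < 36 * Q], so the bound by the loss at [theta_star] is again of order
   [tau]. *)
apply: (@le_trans _ _ (1 - (expR (- t))%:E)%E).
  by rewrite -EFinB lee_fin et; lra.
apply: le_trans (small_sample hX_indep hX_law hY_val hY_indep hY_law t) _.
apply: le_measure; rewrite ?inE//; first exact: measurable_log_likelihood_ratio_le.
move=> w /= /le_trans; apply.
have h : n%:R / signal theta_star <= 36 * Q by rewrite ler_pdivrMr// ltW.
by move: (n%:R / _) h => a; rewrite /K /Q /tau; lra.
Qed.
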